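(* Let $X$ be a real Banach space and $K\subset X$ a nonempty compact set. Let $V_n=\pi^{n/2}/\Gamma(\frac n2+1)$ be the volume of the Euclidean unit ball in $\mathbb{R}^n$. (a) For any sequence $\{\alpha_n\}\subset(0,1]$, any $N\ge 1$, and any run of the weak reduced basis greedy algorithm (defined in the context) with input $K$, $N$, $\{\alpha_n\}$, one has for every $1\le n\le N$ $$\sup_{f\in K}\mathrm{dist}(f,X_{n-1})\le(\alpha_1\cdots\alpha_n)^{-\frac1n}\,\delta_{X,n}\,(n!V_n)^{\frac1n}\,\varepsilon_n(\mathrm{co}(K)).$$ (b) In particular, for any run of the generalized empirical interpolation method (defined in the context) with input $K$, $\mathcal{L}$, $N$, one has for every $1\le n\le N$ $$\sup_{f\in K}\|f-\Pi_{n-1}f\|\le\gamma_{n-1}\,(\gamma_1\cdots\gamma_{n-1})^{\frac1n}\,\delta_{X,n}\,(n!V_n)^{\frac1n}\,\varepsilon_n(\mathrm{co}(K)),$$ where $\gamma_0=1$, $\gamma_k=\|I-\Pi_k\|_{K'}$ for $k\ge1$, and the empty product (case $n=1$) equals $1$.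
   Context: $\|\cdot\|$ is the norm of $X$, and $\mathrm{dist}(f,Y)=\inf_{g\in Y}\|f-g\|$. Symmetric convex hull: $\mathrm{co}(K)$ is the closure in $X$ of $\{\sum_i c_ig_i:\ \sum_i|c_i|\le1,\ g_i\in K\}$ (finite sums). Entropy numbers: $\varepsilon_n(\mathrm{co}(K))=\inf\{\varepsilon>0:\ \mathrm{co}(K)\text{ is covered by }2^n\text{ balls of }X\text{ of radius }\varepsilon\}$. $\delta_{X,n}=\sup_{Y_n\subset X,\ \dim Y_n=n}\ \inf_{T}\|T\|_{Y_n\to\ell_2^n}\|T^{-1}\|_{\ell_2^n\to Y_n}$, where the infimum is over all linear isomorphisms $T:Y_n\to\ell_2^n$, and $\ell_2^n$ is $\mathbb{R}^n$ with the Euclidean norm. Weak reduced basis greedy algorithm. Input: compact $K\subset X$, integer $N$, sequence $\{\alpha_n\}\subset(0,1]$. Set $X_0=\{0\}$. For $n=1,\dots,N$: select any $f_n\in K$ with $\mathrm{dist}(f_n,X_{n-1})\ge\alpha_n\sup_{f\in K}\mathrm{dist}(f,X_{n-1})$; set $X_n=\mathrm{span}\{f_1,\dots,f_n\}$. Generalized empirical interpolation method (EIM). Input: compact $K\subset X$, a collection $\mathcal{L}$ of bounded linear functionals on $\mathrm{span}\{K\}$ (the linear span of $K$, with the norm of $X$), integer $N\ge1$. Set $X_0=\{0\}$ and $\Pi_0=0$. For $n=1,\dots,N$: Step 1: select $f_n\in K$ with $r_n:=f_n-\Pi_{n-1}f_n$ satisfying $\|r_n\|=\max_{f\in K}\|f-\Pi_{n-1}f\|$.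 Step 2: $X_n=\mathrm{span}\{f_1,\dots,f_n\}$. Step 3: select $\ell_n\in\mathcal{L}$ with $|\ell_n(r_n)|=\max_{\ell\in\mathcal{L}}|\ell(r_n)|$. Step 4: $g_n:=r_n/\ell_n(r_n)$ and $B_n=(\ell_i(g_j))_{1\le i,j\le n}$. Step 5: define $\Pi_n:\mathrm{span}\{K\}\to X_n$ by $\Pi_nf=c_1g_1+\cdots+c_ng_n$, with $(c_1,\dots,c_n)^\top=B_n^{-1}(\ell_1(f),\dots,\ell_n(f))^\top$. Standing assumption: the EIM is well-defined for $n\le N$, i.e. the maxima above are attained and $\ell_n(r_n)\neq0$. Then $B_n$ is lower triangular with unit diagonal, $g_1,\dots,g_n$ is a basis of $X_n$, and $\Pi_n^2=\Pi_n$. For a linear operator $A$ on $\mathrm{span}\{K\}$, $\|A\|_{K'}=\sup_{0\ne g\in\mathrm{span}\{K\}}\|Ag\|/\|g\|$; $I$ is the identity. *)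

(* Defs.v *)
From HB Require Import structures.
From mathcomp Require Import all_boot all_order all_algebra.
From mathcomp Require Import all_classical all_reals all_analysis.
Import Order.TTheory GRing.Theory Num.Theory.
Import numFieldNormedType.Exports.

Set Implicit Arguments.
Unset Strict Implicit.
Unset Printing Implicit Defensive.

Local Open Scope classical_set_scope.
Local Open Scope ring_scope.

(* Euler's Gamma function; the integral converges for [0 < a]. *)
Definition Gamma {R : realType} (a : R) : R :=
  \int[lebesgue_measure]_(t in `]0, +oo[%classic) (t `^ (a - 1) * expR (- t)).

Definition ball_volume {R : realType} (n : nat) : R :=
  pi `^ (n%:R / 2) / Gamma (n%:R / 2 + 1).

(* Supremum taken in [0, +oo]: unlike [ereal_sup], it sends the empty set to 0,
   e.g. when X has no n-dimensional subspace. *)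
Definition sup_ge0 {R : realType} (A : set \bar R) : \bar R :=
  maxe 0%E (ereal_sup A).

(* The norm that the library puts on ['rV[R]_n] is the sup norm. *)
Definition l2norm {R : realType} {n : nat} (v : 'rV[R]_n) : R :=
  Num.sqrt (\sum_(i < n) v 0 i ^+ 2).

Section LinearAlgebra.
Context {R : realType}.

Definition lspan {V : lmodType R} (A : set V) : set V :=
  [set x | exists (m : nat) (c : 'I_m -> R) (a : 'I_m -> V),
    (forall i, A (a i)) /\ x = \sum_(i < m) c i *: a i].

Definition lin_indep {V : lmodType R} {n : nat} (e : 'I_n -> V) : Prop :=
  forall c : 'I_n -> R, \sum_(i < n) c i *: e i = 0 -> forall i, c i = 0.

Definition subspace_of_dim {V : lmodType R} (n : nat) (Y : set V) : Prop :=
  exists2 e : 'I_n -> V, lin_indep e & Y = lspan (range e).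

(* Linear maps defined on a subspace [D] are represented by total functions
   whose values outside [D] are irrelevant. *)
Definition linear_on {U V : lmodType R} (D : set U) (A : U -> V) : Prop :=
  forall (a : R) (x y : U), D x -> D y -> A (a *: x + y) = a *: A x + A y.

Definition op_norm {U V : lmodType R} (D : set U)
    (normU : U -> R) (normV : V -> R) (A : U -> V) : \bar R :=
  sup_ge0 [set (normV (A u) / normU u)%:E | u in [set u | D u /\ u <> 0]].

Definition linear_iso {U V : lmodType R} (D : set U)
    (T : U -> V) (Tinv : V -> U) : Prop :=
  [/\ linear_on D T,
      forall u, D u -> Tinv (T u) = u
    & forall v, D (Tinv v) /\ T (Tinv v) = v].

End LinearAlgebra.

Section Banach.
Context {R : realType} {X : completeNormedModType R}.
Local Notation nrm := (fun x : X => `|x|).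

Definition dist (f : X) (Y : set X) : R := inf [set `|f - g| | g in Y].

Definition sym_hull (K : set X) : set X :=
  closure [set x | exists (m : nat) (c : 'I_m -> R) (g : 'I_m -> X),
    [/\ \sum_(i < m) `|c i| <= 1, forall i, K (g i)
      & x = \sum_(i < m) c i *: g i]].

(* Open balls are used; closed balls give the same infimum. *)
Definition entropy_number (n : nat) (A : set X) : \bar R :=
  ereal_inf [set e%:E | e in [set e : R | 0 < e /\
    exists c : 'I_(2 ^ n) -> X, A `<=` \bigcup_(i in setT) ball (c i) e]].

(* [Tinv], the inverse of [T], is automatically linear. *)
Definition dist_l2 (n : nat) (Y : set X) : \bar R :=
  ereal_inf [set d | exists (T : X -> 'rV[R]_n) (Tinv : 'rV[R]_n -> X),
    linear_iso Y T Tinv /\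
    d = (op_norm Y nrm l2norm T * op_norm setT l2norm nrm Tinv)%E].

Definition delta (n : nat) : \bar R :=
  sup_ge0 [set dist_l2 n Y | Y in [set Y : set X | subspace_of_dim n Y]].

(* Sequences produced by the algorithms are indexed from 1; their value at 0 is
   irrelevant. *)
Definition Xspan (f : nat -> X) (n : nat) : set X :=
  lspan [set f i | i in [set i | (1 <= i <= n)%N]].

Definition sup_dist (K Y : set X) : \bar R :=
  sup_ge0 [set (dist f Y)%:E | f in K].

Definition weak_greedy_run (K : set X) (N : nat) (alpha : nat -> R)
    (f : nat -> X) : Prop :=
  forall n, (1 <= n <= N)%N ->
    K (f n) /\
    ((alpha n)%:E * sup_dist K (Xspan f n.-1) <= (dist (f n) (Xspan f n.-1))%:E)%E.

Definition bounded_functional (D : set X) (l : X -> R^o) : Prop :=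
  linear_on D l /\ exists C : R, forall x, D x -> `|l x| <= C * `|x|.

Definition eim_matrix (l : nat -> X -> R^o) (g : nat -> X) (n : nat) : 'M[R]_n :=
  \matrix_(i < n, j < n) l i.+1 (g j.+1).

Definition eim_coef (l : nat -> X -> R^o) (g : nat -> X) (n : nat) (x : X) :
    'cV[R]_n :=
  invmx (eim_matrix l g n) *m \col_(i < n) l i.+1 x.

(* A run includes the standing assumption that all the maxima are attained and
   that [l n (r n)] does not vanish. *)
Record eim_run (K : set X) (L : set (X -> R^o)) (N : nat)
    (f : nat -> X) (l : nat -> X -> R^o) (r g : nat -> X) (Pi : nat -> X -> X) :
    Prop := EimRun {
  eim_Pi0 : forall x, lspan K x -> Pi 0%N x = 0;
  eim_r : forall n, (1 <= n <= N)%N -> r n = f n - Pi n.-1 (f n);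
  eim_f_in : forall n, (1 <= n <= N)%N -> K (f n);
  eim_f_max : forall n, (1 <= n <= N)%N ->
    forall h, K h -> `|h - Pi n.-1 h| <= `|r n|;
  eim_l_in : forall n, (1 <= n <= N)%N -> L (l n);
  eim_l_max : forall n, (1 <= n <= N)%N ->
    forall m, L m -> `|m (r n)| <= `|l n (r n)|;
  eim_l_neq0 : forall n, (1 <= n <= N)%N -> l n (r n) != 0;
  eim_g : forall n, (1 <= n <= N)%N -> g n = (l n (r n))^-1 *: r n;
  eim_Pi : forall n, (1 <= n <= N)%N -> forall x, lspan K x ->
    Pi n x = \sum_(j < n) eim_coef l g n x j 0 *: g j.+1
}.

Definition eim_gamma (K : set X) (Pi : nat -> X -> X) (k : nat) : \bar R :=
  if k is 0%N then 1%E
  else op_norm (lspan K) nrm nrm (fun x => x - Pi k x).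

End Banach.

Arguments delta {R} X n.

(* Main.v *)
Require Import Defs.
From HB Require Import structures.
From mathcomp Require Import all_boot all_order all_algebra.
From mathcomp Require Import all_classical all_reals all_analysis.
From mathcomp Require Import measurable_realfun ring lra.
Import Order.TTheory GRing.Theory Num.Theory.
Import numFieldNormedType.Exports.
Local Open Scope classical_set_scope.
Local Open Scope ring_scope.

Set Implicit Arguments.
Unset Strict Implicit.
Unset Printing Implicit Defensive.

(** Why the bounds hold.  Fix [n] elements [f_1, ..., f_n] of [K] such that the
    distance of [f_k] to the span of its predecessors is at least [tau_k > 0],
    and an isomorphism [T] of their span onto Euclidean space.  The symmetric
    convex hull of [K] contains the cross-polytope with vertices [+- f_k].
    Orthogonalising [T f_1, ..., T f_n], the image of the cross-polytope under
    [T] has volume [2^n / n!] times a product of [n] heights, and the [k]-th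
    height is at least [tau_k / |T^-1|].  If the hull is covered by [2^n] balls
    of radius [eps], each of them meets the span in a set whose image under [T]
    has Euclidean diameter at most [2 |T| eps]; by the isodiametric inequality
    its volume is at most [V_n (|T| eps)^n], wherever the centre of the ball
    lies.  Comparing volumes, the two factors [2^n] cancel and
      [tau_1 ... tau_n <= n! V_n (|T| |T^-1| eps)^n].
    Optimising over [T] and [eps] gives [prod_dist_le_delta].

    For a weak greedy run one takes [tau_k = alpha_k sigma], where [sigma] is
    the error to be bounded, because the errors decrease with [k].  An
    interpolation run is a weak greedy run with [alpha_k = 1 / gamma_(k-1)]:
    [Pi_(k-1)] is a projection onto [X_(k-1)], so that [|h - Pi_(k-1) h|] lies
    between the distance of [h] to [X_(k-1)] and [gamma_(k-1)] times this
    distance.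

    The volumes live on an iterated product of lines, where every ingredient is
    an induction on the dimension by Tonelli's theorem: [isodiametric] is one
    half-step of Steiner symmetrisation, [crosspolytope_vol] integrates the
    sections of a cross-polytope, and [le_ball_volume] compares with the
    Gaussian integral, which is [pi^(n/2)] on one side and a Gamma integral on
    the other. *)

(** * Euclidean space as an iterated product of lines *)

(** The display of an [n]-fold product depends on [n]; bundling it with the type
    is what makes a recursion on [n] possible. *)
Record mspace (R : realType) := MSpace {
  ms_disp : measure_display;
  ms_type :> measurableType ms_disp;
  ms_vol : {sigma_finite_measure set ms_type -> \bar R}
}.

Section LineTimes.
Context {R : realType} (S : mspace R).

(** A name of its own lets the product carry a sigma-finite structure, which is
    needed to iterate it. *)
Definition line_times_vol : set (measurableTypeR R * S) -> \bar R :=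
  product_measure1 (@lebesgue_measure R) (ms_vol S).

HB.instance Definition _ := Measure.on line_times_vol.

Let line_times_vol_sigma_finite : sigma_finite setT line_times_vol.
Proof.
have /sigma_finiteP[F [TF ndF Foo]] := sigma_finiteT (@lebesgue_measure R).
have /sigma_finiteP[G [TG ndG Goo]] := sigma_finiteT (ms_vol S).
exists (fun n => F n `*` G n) => [|k]; last first.
  have [mF Fk] := Foo k; have [mG Gk] := Goo k.
  split; first exact: measurableX.
  by rewrite /line_times_vol product_measure1E// lte_mul_pinfty// ge0_fin_numE.
apply/esym/seteqP; split => // -[x t] _.
have [n _ Fnx] : (\bigcup_i F i) x by rewrite -TF.
have [m _ Gmt] : (\bigcup_i G i) t by rewrite -TG.
exists (maxn n m) => //; split => /=.
  by move: x Fnx; exact/subsetPset/ndF/leq_maxl.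
by move: t Gmt; exact/subsetPset/ndG/leq_maxr.
Qed.

HB.instance Definition _ :=
  Measure_isSigmaFinite.Build _ _ _ line_times_vol line_times_vol_sigma_finite.

Definition line_times : mspace R := MSpace line_times_vol.

End LineTimes.

Fixpoint coord (R : realType) (n : nat) : mspace R :=
  if n is m.+1 then line_times (coord R m)
  else @MSpace R _ unit (@dirac _ unit tt R).

Fixpoint sqdist {R : realType} (n : nat) : coord R n -> coord R n -> R :=
  if n is m.+1 then fun t u => (t.1 - u.1) ^+ 2 + sqdist t.2 u.2 else fun _ _ => 0.

Fixpoint sqnorm {R : realType} (n : nat) : coord R n -> R :=
  if n is m.+1 then fun t => t.1 ^+ 2 + sqnorm t.2 else fun _ => 0.

Section Coordinates.
Context {R : realType}.
Local Notation lambda := (@lebesgue_measure R).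
Local Notation vol n := (ms_vol (coord R n)).

Lemma measurable_sqnorm n : measurable_fun setT (@sqnorm R n).
Proof.
elim: n => [|n IH] /=; first exact: measurable_cst.
apply: measurable_funD.
  by apply: measurable_funX; exact: measurable_fst.
by apply: (measurableT_comp IH); exact: measurable_snd.
Qed.

Lemma measurable_sqnorm_lt n (rho : R) : measurable [set t : coord R n | sqnorm t < rho].
Proof.
rewrite -[X in measurable X]setTI.
by apply: measurable_fun_ltr => //; exact: measurable_sqnorm.
Qed.

Lemma vol_xsection n (A : set (coord R n.+1)) :
  vol n.+1 A = (\int[lambda]_x vol n (xsection A x))%E.
Proof. by []. Qed.

Lemma measurable_vol_xsection n (A : set (coord R n.+1)) : measurable A ->
  measurable_fun setT (fun x : measurableTypeR R => vol n (xsection A x)).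
Proof. by move=> mA; exact: (@measurable_fun_xsection _ _ _ _ _ (vol n) A mA). Qed.

Lemma vol_ysection n (A : set (coord R n.+1)) : measurable A ->
  vol n.+1 A = (\int[vol n]_t lambda (ysection A t))%E.
Proof.
move=> mA; rewrite -[RHS]/(product_measure2 _ _ A).
apply: (@product_measure_unique _ _ _ _ _ lambda (vol n)
  (product_measure2 lambda (vol n))) => // B C mB mC.
exact: product_measure2E.
Qed.

End Coordinates.

(** * The isodiametric inequality *)

Section Isodiametric.
Context {R : realType}.
Local Notation lambda := (@lebesgue_measure R).
Local Notation vol n := (ms_vol (coord R n)).

Lemma lebesgue_measure_sub_itv (A : set R) (p q w : R) : measurable A ->
  0 <= w -> A `<=` `[p, q]%classic -> q - p <= w -> (lambda A <= w%:E)%E.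
Proof.
move=> mA w0 Apq pqw.
apply: (@le_trans _ _ (lambda `[p, q]%classic)).
  by apply: le_measure; rewrite ?inE//; exact: measurable_itv.
rewrite lebesgue_measure_itv/=; case: ifPn => _; last by rewrite lee_fin.
by rewrite -EFinB lee_fin.
Qed.

(** Otherwise [A] would lie in an interval of length [2 w - (sup B - inf B)], and
    [B] in one of length [sup B - inf B]; one of these two lengths is at most
    [w]. *)
Lemma exists_far_points (A B : set R) (w : R) : measurable A -> measurable B ->
  0 <= w -> (w%:E < lambda A)%E -> (w%:E < lambda B)%E ->
  exists a b, [/\ A a, B b & w < `|a - b|].
Proof.
move=> mA mB w0 wA wB; apply: contrapT => near.
have {}near a b : A a -> B b -> `|a - b| <= w.
  by move=> Aa Bb; rewrite leNgt; apply/negP => ?; apply: near; exists a, b.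
have [a Aa] : A !=set0.
  apply/set0P/negP => /eqP A0; move: wA.
  by rewrite A0 measure0 lte_fin ltNge w0.
have B0 : B !=set0.
  apply/set0P/negP => /eqP B0; move: wB.
  by rewrite B0 measure0 lte_fin ltNge w0.
have ubB c : A c -> ubound B (c + w).
  by move=> Ac b Bb; have := near _ _ Ac Bb; rewrite ler_norml; lra.
have lbB c : A c -> lbound B (c - w).
  by move=> Ac b Bb; have := near _ _ Ac Bb; rewrite ler_norml; lra.
have hsB : has_sup B by split => //; exists (a + w); exact: ubB.
have hiB : has_inf B by split => //; exists (a - w); exact: lbB.
have BI : B `<=` `[inf B, sup B]%classic.
  move=> b Bb; rewrite /= in_itv/=.
  have ? := ge_inf hiB.2 Bb; have ? := ub_le_sup hsB.2 Bb.
  by apply/andP; split.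
have AI : A `<=` `[sup B - w, inf B + w]%classic.
  move=> c Ac; rewrite /= in_itv/=.
  have := lb_le_inf B0 (lbB _ Ac); have := ge_sup B0 (ubB _ Ac).
  by move=> ? ?; apply/andP; split; lra.
have [siw|siw] := leP (sup B - inf B) w.
  have := lebesgue_measure_sub_itv mB w0 BI siw.
  by rewrite leNgt wB.
have : (lambda A <= w%:E)%E.
  by apply: (lebesgue_measure_sub_itv mA w0 AI); lra.
by rewrite leNgt wA.
Qed.

(** Replace every section of [E] along the first coordinate by the centred
    interval of the same length.  This preserves the volume.  The section of the
    new set at abscissa [x] consists of the [t] whose line is longer than
    [2 |x|]; two such lines contain points more than [2 |x|] apart, so that
    squared distances in this section are below [4 (rho - x^2)], and the
    induction hypothesis compares it with the section of the ball at [x]. *)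
Lemma isodiametric n (E : set (coord R n)) (rho : R) : measurable E ->
  (forall t u, E t -> E u -> sqdist t u < 4 * rho) ->
  (vol n E <= vol n [set t | (sqnorm t < rho)%R])%E.
Proof.
elim: n E rho => [|n IH] E rho mE diamE.
  apply: le_measure; rewrite ?inE//.
  by move=> t Et /=; have /= := diamE _ _ Et Et; lra.
pose phi (t : coord R n) := lambda (ysection E t).
have mphi : measurable_fun setT phi by exact: measurable_fun_ysection.
pose E' : set (coord R n.+1) := [set z | (`|z.1| *+ 2)%:E < phi z.2]%E.
have mE' : measurable E'.
  rewrite -[X in measurable X]setTI; apply: measurable_lte => //.
  - apply/measurable_EFinP; apply: (measurableT_comp (natmul_measurable _)).
    by apply: measurableT_comp => //; exact: measurable_fst.
  - by apply: (measurableT_comp mphi); exact: measurable_snd.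
(* Equality on the sections along the first coordinate. *)
have -> : vol n.+1 E = vol n.+1 E'.
  rewrite !vol_ysection//; apply: eq_integral => t _; rewrite -/(phi t).
  rewrite (_ : ysection E' t = [set x | (`|x| *+ 2)%:E < phi t]%E); last first.
    by apply/seteqP; split => x; rewrite /ysection/= inE.
  have : (0 <= phi t)%E by exact: measure_ge0.
  case: (phi t) => [r| |]; rewrite ?lee_fin => // r0.
    rewrite (_ : [set _ | _] = ball (0 : R) (r / 2)).
      by rewrite lebesgue_measure_ball ?divr_ge0//; congr EFin; lra.
    apply/seteqP; split => x /=; rewrite lte_fin -ball_normE/= sub0r normrN => ?; lra.
  rewrite (_ : [set _ | _] = [set` `]-oo, +oo[]); last first.
    by rewrite set_itvE; apply/seteqP; split => x //= _; rewrite ltry.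
  by rewrite lebesgue_measure_itv.
rewrite !vol_xsection; apply: ge0_le_integral => //.
- exact: measurable_vol_xsection.
- apply: measurable_vol_xsection.
  exact: (@measurable_sqnorm_lt R n.+1).
move=> x _.
rewrite (_ : xsection [set t : coord R n.+1 | sqnorm t < rho] x =
    [set t | sqnorm t < rho - x ^+ 2]); last first.
  by apply/seteqP; split => t; rewrite /xsection/= inE/= ltrBrDl.
apply: IH; first exact: measurable_xsection.
move=> t u; rewrite /xsection/= !inE/= => tx ux.
have mY v : measurable (ysection E v) by exact: measurable_ysection.
have [a [b [Ea Eb]]] := exists_far_points (mY t) (mY u) (mulrn_wge0 2 (normr_ge0 x)) tx ux.
move: Ea Eb; rewrite /ysection/= !inE => Ea Eb xab.
have := diamE _ _ Ea Eb => /=.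
have : (`|x| *+ 2) ^+ 2 < `|a - b| ^+ 2 by rewrite ltr_pXn2r ?nnegrE ?mulrn_wge0.
rewrite -[X in X ^+ 2 < _]mulr_natr exprMn !real_normK ?num_real//; lra.
Qed.

End Isodiametric.

(** * Volume of a cross-polytope *)

(** The outermost component has the largest index, so that the last vector of a
    triangular system is the first one to be integrated out. *)
Fixpoint of_coords {R : realType} (n : nat) (a : nat -> R) : coord R n :=
  if n is m.+1 then (a m, of_coords m a) else tt.

Section CrossPolytope.
Context {R : realType}.
Local Notation lambda := (@lebesgue_measure R).
Local Notation vol n := (ms_vol (coord R n)).

Lemma integral_itv_deriv_poly (P : {poly R}) (p q : R) : p < q ->
  (\int[lambda]_(x in `]p, q[) (P^`().[x])%:E = (P.[q] - P.[p])%:E)%E.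
Proof.
move=> pq; have mP (A : set R) : measurable_fun A (EFin \o horner P^`()).
  apply/measurable_EFinP; apply: measurable_funTS.
  by apply: continuous_measurable_fun; exact: continuous_horner.
rewrite integral_itv_obnd_cbnd// integral_itv_bndo_bndc//.
rewrite (continuous_FTC2 pq (F := horner P)) ?EFinB//.
- by apply: continuous_subspaceT; exact: continuous_horner.
- split=> [x _||]; first exact: derivable_horner.
  + by apply: cvg_at_right_filter; exact: continuous_horner.
  + by apply: cvg_at_left_filter; exact: continuous_horner.
- by move=> x _; rewrite derivE.
Qed.

(** [U] is any measurable set containing the cross-polytope of centre [a] and
    size [s] spanned by the rows of a triangular matrix.  At abscissa [x], the
    last coefficient has to be [c_n = (x - a_n) / M_nn], and what is left is a
    cross-polytope of size [s - |c_n|] spanned by the other rows, with a centre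
    shifted by [c_n] times the last row; hence the free centre [a]. *)
Lemma crosspolytope_vol n (M : nat -> nat -> R) (U : set (coord R n)) (s : R)
    (a : nat -> R) :
  measurable U -> 0 < s ->
  (forall k, (k < n)%N -> 0 < M k k) ->
  (forall k j, (k < j < n)%N -> M k j = 0) ->
  (forall c : nat -> R, \sum_(k < n) `|c k| < s ->
     U (of_coords n (fun j => a j + \sum_(k < n) c k * M k j))) ->
  (((2 * s) ^+ n / n`!%:R * \prod_(k < n) M k k)%:E <= vol n U)%E.
Proof.
elim: n U s a => [|n IH] U s a mU s0 Mpos Mtrig inU.
  have /= Utt := inU (fun=> 0).
  rewrite expr0 big_ord0 divr1 mulr1 /= diracE mem_set//.
  by apply: Utt; rewrite big_ord0.
set d := M n n; have d0 : 0 < d by exact: Mpos.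
pose K := 2 ^+ n / n`!%:R * \prod_(k < n) M k k.
have K0 : 0 <= K.
  rewrite mulr_ge0 ?divr_ge0 ?exprn_ge0// prodr_ge0// => k _.
  by rewrite ltW// Mpos// ltnW// ltnS.
pose m := a n; pose p := m - s * d; pose q := m + s * d.
have sd0 : 0 < s * d by rewrite mulr_gt0.
have slice x r : 0 < r -> r = s - `|x - m| / d ->
    ((K * r ^+ n)%:E <= vol n (xsection U x))%E.
  move=> r0 rE; pose c := (x - m) / d.
  have cE : `|c| = `|x - m| / d by rewrite normrM normfV (gtr0_norm d0).
  have := @IH (xsection U x) r (fun j => a j + c * M n j).
  rewrite (_ : (2 * r) ^+ n / _ * _ = K * r ^+ n); last first.
    by rewrite /K exprMn; ring.
  apply => //.
  - exact: measurable_xsection.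
  - by move=> k kn; apply: Mpos; exact: ltnW.
  - by move=> k j /andP[kj jn]; apply: Mtrig; rewrite kj/= ltnW.
  move=> e es; rewrite /xsection/= inE.
  have /(inU (fun k => if (k < n)%N then e k else c)) :
      \sum_(k < n.+1) `|if (k < n)%N then e k else c| < s.
    rewrite big_ord_recr/= ltnn cE.
    under eq_bigr do rewrite ltn_ord.
    by move: es; rewrite rE; lra.
  rewrite /=; congr (U (_, _)).
    rewrite big_ord_recr/= ltnn big1 ?add0r => [|k _].
      by rewrite /c divfK ?gt_eqF// /m; lra.
    by rewrite Mtrig ?mulr0//= ltn_ord/=.
  congr of_coords; apply/funext => j; rewrite big_ord_recr/= ltnn -addrA; congr (_ + _).
  by rewrite addrC; congr (_ + _); apply: eq_bigr => k _; rewrite ltn_ord.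
rewrite vol_xsection.
have mv (A : set R) : measurable_fun A (fun x : measurableTypeR R => vol n (xsection U x)).
  by apply: measurable_funTS; exact: measurable_vol_xsection.
pose C := K / d ^+ n / n.+1%:R.
have CK (x : R) : C * (x ^+ n *+ n.+1) = K * (x / d) ^+ n.
  rewrite -mulr_natr exprMn exprVn /C; field.
  by rewrite ?expf_neq0 ?gt_eqF ?pnatr_eq0.
(* On each side of the centre the bound for the sections is a polynomial, and
   the two sides contribute the same integral. *)
have half (P : {poly R}) u v : u < v ->
    (forall x, x \in `]u, v[ -> exists r, [/\ 0 < r, r = s - `|x - m| / d &
       P^`().[x] = K * r ^+ n]) ->
    ((P.[v] - P.[u])%:E <= \int[lambda]_(x in `]u, v[) vol n (xsection U x))%E.
  move=> uv rP; rewrite -integral_itv_deriv_poly//; apply: ge0_le_integral => //=.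
  - move=> x xuv; have [r [r0 _ ->]] := rP x xuv.
    by rewrite lee_fin mulr_ge0// exprn_ge0// ltW.
  - apply/measurable_EFinP; apply: measurable_funTS.
    by apply: continuous_measurable_fun; exact: continuous_horner.
  - exact: mv.
  - by move=> x xuv; have [r [r0 rE ->]] := rP x xuv; exact: slice.
have P'E (P : {poly R}) k x : (C *: (P ^+ k.+1))^`().[x] =
    C * (P.[x] ^+ k *+ k.+1) * P^`().[x].
  by rewrite derivZ deriv_exp !hornerE hornerMn !hornerE; ring.
have left : ((K * s ^+ n.+1 * d / n.+1%:R)%:E <=
    \int[lambda]_(x in `]p, m[) vol n (xsection U x))%E.
  have pm : p < m by rewrite /p; lra.
  have := half (C *: ('X - p%:P) ^+ n.+1) p m pm.
  rewrite !hornerE subrr expr0n/= mulr0 subr0.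
  rewrite (_ : C * _ = K * s ^+ n.+1 * d / n.+1%:R); last first.
    rewrite /C (_ : m - p = s * d) ?exprMn ?exprS; last by rewrite /p; lra.
    by field; rewrite ?expf_neq0 ?gt_eqF ?pnatr_eq0.
  apply => x; rewrite in_itv/= => /andP[px xm]; exists ((x - p) / d).
  have rE : (x - p) / d = s - `|x - m| / d.
    by rewrite ltr0_norm ?subr_lt0// /p; field; rewrite gt_eqF.
  split=> //; first by rewrite divr_gt0// subr_gt0.
  by rewrite P'E derivB derivX derivC subr0 !hornerE CK.
have right : ((K * s ^+ n.+1 * d / n.+1%:R)%:E <=
    \int[lambda]_(x in `]m, q[) vol n (xsection U x))%E.
  have mq : m < q by rewrite /q; lra.
  have := half ((- C) *: (q%:P - 'X) ^+ n.+1) m q mq.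
  rewrite !hornerE subrr expr0n/= mulr0 sub0r mulNr opprK.
  rewrite (_ : C * _ = K * s ^+ n.+1 * d / n.+1%:R); last first.
    rewrite /C (_ : q - m = s * d) ?exprMn ?exprS; last by rewrite /q; lra.
    by field; rewrite ?expf_neq0 ?gt_eqF ?pnatr_eq0.
  apply => x; rewrite in_itv/= => /andP[mx xq]; exists ((q - x) / d).
  have rE : (q - x) / d = s - `|x - m| / d.
    by rewrite gtr0_norm ?subr_gt0// /q; field; rewrite gt_eqF.
  split=> //; first by rewrite divr_gt0// subr_gt0.
  rewrite scaleNr derivN hornerN P'E derivB derivX derivC sub0r !hornerE.
  by rewrite CK; ring.
apply: (@le_trans _ _ (\int[lambda]_(x in `]p, m[ `|` `]m, q[) vol n (xsection U x))%E); last first.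
  apply: ge0_subset_integral => //; first exact: measurableU.
  exact: mv.
rewrite ge0_integral_setU//; last 2 first.
- exact: mv.
- apply/disj_setPS => x [/=]; rewrite !in_itv/=; lra.
apply: le_trans (leeD left right).
rewrite -EFinD lee_fin big_ord_recr/= -/d factS natrM invfM /K.
rewrite le_eqVlt; apply/orP; left; apply/eqP.
rewrite exprMn !exprS; field.
by rewrite nat1r !pnatr_eq0 /= -lt0n fact_gt0.
Qed.

End CrossPolytope.

(** * Volume of the Euclidean ball *)

Section GaussianVolume.
Context {R : realType}.
Local Notation lambda := (@lebesgue_measure R).
Local Notation vol n := (ms_vol (coord R n)).

Lemma integral_gauss_coord n :
  (\int[vol n]_t (expR (- sqnorm t)%R)%:E = (Num.sqrt pi ^+ n)%R%:E)%E.
Proof.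
elim: n => [|n IH].
  by rewrite /= integral_dirac// diracT mul1e oppr0 expR0.
have m1 : measurable_fun setT (fun t : coord R n => (expR (- sqnorm t)%R)%:E).
  apply/measurable_EFinP; apply: (measurableT_comp (@measurable_expR R)).
  by apply: measurableT_comp => //; exact: measurable_sqnorm.
have m2 : measurable_fun setT (fun t : coord R n.+1 => (expR (- sqnorm t)%R)%:E).
  apply/measurable_EFinP; apply: (measurableT_comp (@measurable_expR R)).
  by apply: measurableT_comp => //; exact: (@measurable_sqnorm R n.+1).
rewrite [LHS](fubini_tonelli1 (m1 := lambda) (m2 := vol n) _ m2); last first.
  by move=> t; rewrite lee_fin expR_ge0.
rewrite /fubini_F /=.
rewrite (eq_integral (fun x : measurableTypeR R =>
    (gauss_fun x)%:E * (Num.sqrt pi ^+ n)%R%:E)%E); last first.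
  move=> x _; under eq_integral => t _ do rewrite opprD expRD EFinM.
  rewrite ge0_integralZl ?IH// => [t _|]; by rewrite lee_fin expR_ge0.
rewrite ge0_integralZr//.
- by rewrite integralT_gauss -EFinM exprS.
- by apply/measurable_EFinP; exact: measurable_gauss_fun.
- by move=> x _; rewrite lee_fin expR_ge0.
Qed.

Lemma integral_expRN_tail (s : R) :
  (\int[lambda]_(u in `]s, +oo[) (expR (- u)%R)%:E = (expR (- s)%R)%:E)%E.
Proof.
have dF (x : R) : is_derive x 1 (fun x : R => - expR (- x)) (expR (- x)).
  by apply: is_derive_eq; rewrite mulrN1 opprK.
have cE : continuous (fun x : R => expR (- x)).
  move=> x; apply: (@continuous_comp _ _ _ -%R expR); first exact: opp_continuous.
  exact: continuous_expR.
rewrite integral_itv_obnd_cbnd; last first.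
  apply/measurable_EFinP; apply: measurable_funTS.
  exact: continuous_measurable_fun.
rewrite (@ge0_continuous_FTC2y _ _ (fun x => - expR (- x)) _ 0).
- by rewrite sub0e -EFinN opprK.
- by move=> x _; exact: expR_ge0.
- exact: continuous_subspaceT.
- by rewrite -oppr0; apply: cvgN; exact: cvgr_expR.
- by move=> x _; apply: ex_derive.
- apply: cvg_at_right_filter; apply: cvgN; exact: cE.
- by move=> x _; rewrite derive1E derive_val.
Qed.

(** Write [exp (- s)] as the integral of [exp (- u)] over [u > s] and exchange
    the two integrals. *)
Lemma layer_cake n :
  (\int[vol n]_t (expR (- sqnorm t)%R)%:E =
   \int[lambda]_u (vol n [set t | (sqnorm t < u)%R] * (expR (- u)%R)%:E))%E.
Proof.
pose f (z : coord R n * measurableTypeR R) :=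
  (\1_[set z : coord R n * measurableTypeR R | sqnorm z.1 < z.2] z * expR (- z.2))%:E.
have mA : measurable [set z : coord R n * measurableTypeR R | sqnorm z.1 < z.2].
  rewrite -[X in measurable X]setTI; apply: measurable_fun_ltr => //.
  by apply: (measurableT_comp (@measurable_sqnorm R n)).
have mf : measurable_fun setT f.
  apply/measurable_EFinP; apply: measurable_funM; first exact: measurable_indic.
  apply: (measurableT_comp (@measurable_expR R)).
  by apply: measurableT_comp => //; exact: measurable_snd.
have f0 z : (0 <= f z)%E by rewrite lee_fin mulr_ge0// expR_ge0.
have := @fubini_tonelli _ _ _ _ _ (vol n) lambda f mf f0.
rewrite (_ : (fun x => _) = (fun t => (expR (- sqnorm t)%R)%:E)); last first.
  apply/funext => t; rewrite -integral_expRN_tail [RHS]integral_mkcond.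
  apply: eq_integral => u _; rewrite patchE /f indicE/=.
  rewrite (_ : (t, u) \in _ = (sqnorm t < u)); last by apply/idP/idP; rewrite inE.
  rewrite (_ : u \in _ = (sqnorm t < u)).
    by case: ifPn => _; rewrite ?mul1r ?mul0r.
  by apply/idP/idP; rewrite inE/= in_itv/= andbT.
move=> ->; apply: eq_integral => u _.
rewrite /f; under eq_integral do rewrite /= EFinM.
rewrite ge0_integralZr//; last first.
  apply/measurable_EFinP.
  apply: (measurable_indic (U := [set t : coord R n | sqnorm t < u])).
  exact: measurable_sqnorm_lt.
congr (_ * _)%E; rewrite -[in RHS](setIT [set t | _]) -integral_indic//.
exact: measurable_sqnorm_lt.
Qed.

Lemma measurable_vol_sqnorm_lt n :
  measurable_fun setT (fun u : measurableTypeR R => vol n [set t | (sqnorm t < u)%R]).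
Proof.
pose A : set (coord R n.+1) := [set z | sqnorm z.2 < z.1].
have mA : measurable A.
  rewrite -[X in measurable X]setTI; apply: measurable_fun_ltr => //.
  by apply: (measurableT_comp (@measurable_sqnorm R n)).
rewrite (_ : (fun u => _) = (fun u => vol n (xsection A u))).
  exact: measurable_vol_xsection.
apply/funext => u; congr (vol n _).
by apply/seteqP; split => t; rewrite /xsection/= inE.
Qed.

(** Integrating the hypothesis against [exp (- u)] gives a Gamma integral on the
    left and, by [layer_cake], the Gaussian integral [pi^(n/2)] on the right. *)
Lemma le_ball_volume n (D : R) : 0 <= D ->
  (forall u, 0 < u ->
    (((D * Num.sqrt u ^+ n)%R)%:E <= vol n [set t | (sqnorm t < u)%R])%E) ->
  D <= ball_volume n.
Proof.
move=> D0 DV.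
(* [h] is the integrand of [Gamma] at [n / 2 + 1]. *)
pose h (u : R) : R := u `^ (n%:R / 2 + 1 - 1) * expR (- u).
have h0 u : 0 <= h u by rewrite mulr_ge0 ?powR_ge0 ?expR_ge0.
have mh : measurable_fun setT h.
  apply: measurable_funM; first exact: measurable_powR.
  apply: (measurableT_comp (@measurable_expR R)); exact: oppr_measurable.
have hE u : 0 < u -> h u = Num.sqrt u ^+ n * expR (- u).
  move=> u0; rewrite /h addrK -powR12_sqrt ?ltW// -powR_mulrn ?powR_ge0//.
  by rewrite -powRrM [2^-1 * _]mulrC.
pose G : \bar R := (\int[lambda]_(u in `]0%R, +oo[%classic) (h u)%:E)%E.
have GE : Gamma (n%:R / 2 + 1) = fine G by [].
have G0 : (0 <= G)%E by apply: integral_ge0 => u _; rewrite lee_fin.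
have Gpi : (D%:E * G <= (Num.sqrt pi ^+ n)%R%:E)%E.
  have mv (A : set (measurableTypeR R)) : measurable_fun A
      (fun u => vol n [set t | (sqnorm t < u)%R] * (expR (- u))%:E)%E.
    apply: measurable_funTS; apply: emeasurable_funM.
      exact: measurable_vol_sqnorm_lt.
    apply/measurable_EFinP; apply: (measurableT_comp (@measurable_expR R)).
    exact: oppr_measurable.
  rewrite -integral_gauss_coord layer_cake /G -ge0_integralZl//; last 2 first.
  - by apply/measurable_EFinP; apply: measurable_funTS.
  - by move=> u _; rewrite lee_fin.
  apply: (@le_trans _ _ (\int[lambda]_(u in `]0%R, +oo[%classic)
      (vol n [set t | (sqnorm t < u)%R] * (expR (- u)%R)%:E))%E).
    apply: ge0_le_integral => //.
    - by move=> u _; rewrite mule_ge0// lee_fin.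
    - apply: measurable_funeM; apply/measurable_EFinP.
      exact: measurable_funTS.
    - move=> u; rewrite /= in_itv/= andbT => u0.
      by rewrite hE// EFinM muleA lee_wpmul2r ?lee_fin ?expR_ge0// -EFinM DV.
  apply: ge0_subset_integral => // u _.
  by rewrite mule_ge0// lee_fin expR_ge0.
(* [ball_volume] divides by the real number [fine G], which would be [0] if [G]
   were [0] or [+oo]; [Gpi] excludes the second case. *)
have G_gt0 : (0 < G)%E.
  apply: (@lt_le_trans _ _ (\int[lambda]_(u in `[1%R, 2%R]%classic) (cst (expR (- 2%R))%:E u))%E).
    rewrite integral_cst//= lebesgue_measure_itv/= lte_fin ltr1n.
    by rewrite -EFinB -EFinM lte_fin mulr_gt0 ?expR_gt0//; lra.
  apply: (@le_trans _ _ (\int[lambda]_(u in `[1%R, 2%R]%classic) (h u)%:E)%E).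
    apply: ge0_le_integral => //.
    - by move=> u _; rewrite lee_fin expR_ge0.
    - by apply/measurable_EFinP; exact: measurable_funTS.
    - move=> u; rewrite /= in_itv/= => /andP[u1 u2].
      rewrite lee_fin hE ?(lt_le_trans ltr01)//.
      rewrite -[X in X <= _]mul1r ler_pM ?expR_ge0// ?ler_expR ?lerN2//.
      by rewrite exprn_ege1// -sqrtr1 ler_wsqrtr.
  apply: ge0_subset_integral => //.
  - by apply/measurable_EFinP; exact: measurable_funTS.
  - by move=> u _; rewrite lee_fin.
  - by move=> u; rewrite /= !in_itv/= andbT => /andP[u1 _]; exact: lt_le_trans u1.
have pin : pi `^ (n%:R / 2) = Num.sqrt pi ^+ n :> R.
  by rewrite -powR12_sqrt ?pi_ge0// -powR_mulrn ?powR_ge0// -powRrM mulrC.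
rewrite /ball_volume GE pin.
move: D0; rewrite le_eqVlt => /predU1P[<-|D0].
  by rewrite divr_ge0 ?exprn_ge0 ?sqrtr_ge0 ?fine_ge0.
move: G0 G_gt0 Gpi; case: G {GE} => [g| |] //= _; last first.
  by rewrite gt0_muley ?lte_fin// leye_eq.
by rewrite lte_fin -EFinM lee_fin => g0; rewrite ler_pdivlMr.
Qed.

End GaussianVolume.

(** * Covering a cross-polytope by balls of a norm *)

Section Covering.
Context {R : realType} {X : normedModType R}.
Local Notation vol n := (ms_vol (coord R n)).

Fixpoint lincomb (n : nat) (e : nat -> X) : coord R n -> X :=
  match n return coord R n -> X with
  | m.+1 => fun t => t.1 *: e m + lincomb e t.2
  | 0%N => fun=> 0
  end.

Lemma lincomb_of_coords n e a : lincomb e (of_coords n a) = \sum_(j < n) a j *: e j.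
Proof.
elim: n => [|n IH] /=; first by rewrite big_ord0.
by rewrite IH big_ord_recr addrC.
Qed.

(** By the triangle inequality, a point of this set lies in a rectangle contained
    in the set and described by a rational abscissa and a rational width.  So the
    set is a countable union of measurable rectangles. *)
Lemma measurable_norm_lincomb_lt n e (p : X) (r : R) :
  measurable [set t : coord R n | `|p + lincomb e t| < r].
Proof.
elim: n p r => [|n IH] p r.
  have [rp|pr] := leP r `|p + 0|.
    rewrite [X in measurable X](_ : _ = set0)//.
    by apply/seteqP; split => // t /=; rewrite ltNge rp.
  by rewrite [X in measurable X](_ : _ = setT)//; apply/seteqP; split.
(* Adding 1 keeps the denominator positive when [e n] is [0]. *)
pose E := `|e n| + 1; have E0 : 0 < E by rewrite ltr_wpDl.
pose B (q d : rat) : set (coord R n.+1) :=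
  [set x | `|x - ratr q| < ratr d / E] `*`
  [set t | `|(p + ratr q *: e n) + lincomb e t| < r - ratr d].
have mB q d : measurable (B q d).
  apply: measurableX; last exact: IH.
  rewrite (_ : [set x | _] = ball (ratr q : R) (ratr d / E)); first exact: measurable_ball.
  by apply/seteqP; split => x; rewrite -ball_normE/= [`|_ - x|]distrC.
suff -> : [set t : coord R n.+1 | `|p + lincomb e t| < r] =
    \bigcup_(q : rat) \bigcup_(d : rat) B q d.
  by apply: bigcupT_measurable_rat => q; apply: bigcupT_measurable_rat.
have eE : `|e n| <= E by rewrite lerDl.
apply/seteqP; split => [[x t]|[x t] [q _ [d _ []]]] /=.
- move=> lt_r; pose eta := r - `|p + (x *: e n + lincomb e t)|.
  have eta0 : 0 < eta by rewrite subr_gt0.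
  have /rat_in_itvoo[d] : 0 < eta / 2 by rewrite divr_gt0.
  rewrite in_itv/= => /andP[d0 d_eta].
  have dE : 0 < ratr d / E by rewrite divr_gt0.
  have /rat_in_itvoo[q] : x - ratr d / E < x + ratr d / E by lra.
  rewrite in_itv/= => /andP[q1 q2].
  have xq : `|x - ratr q| < ratr d / E by rewrite ltr_norml; lra.
  exists q => //; exists d => //; split => //=.
  have := ler_normD (p + (x *: e n + lincomb e t)) ((ratr q - x) *: e n).
  rewrite (_ : _ + (ratr q - x) *: _ = p + ratr q *: e n + lincomb e t); last first.
    by rewrite scalerBl -!addrA; congr (_ + _); rewrite addrC -!addrA addNr addr0 addrC.
  rewrite normrZ distrC => /le_lt_trans; apply.
  have : `|x - ratr q| * `|e n| <= ratr d.
    by rewrite (le_trans (ler_wpM2l _ eE))// -ler_pdivlMr// ltW.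
  rewrite /eta in d_eta; lra.
- move=> xq lt_r.
  have := ler_normD (p + ratr q *: e n + lincomb e t) ((x - ratr q) *: e n).
  rewrite (_ : _ + (x - ratr q) *: _ = p + (x *: e n + lincomb e t)); last first.
    rewrite scalerBl -!addrA; congr (_ + _).
    by rewrite addrC -!addrA addNr addr0 addrC.
  move=> /le_lt_trans; apply; rewrite normrZ.
  have : `|x - ratr q| * `|e n| <= ratr d.
    by rewrite (le_trans (ler_wpM2l _ eE))// -ler_pdivlMr// ltW.
  lra.
Qed.
(** The hypothesis on [sqdist] says that the Euclidean norm is at most [A] times
    the norm of [X].  The covering is dilated by every [s > 0], because
    [le_ball_volume] compares with Euclidean balls of all radii.  The centres
    [c i] may lie outside the span of the [e j], which is why the volume of each
    piece is bounded through its diameter. *)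
Lemma prod_le_ball_volume n (e f : nat -> X) (M : nat -> nat -> R) (A eps : R)
    (c : 'I_(2 ^ n) -> X) :
  0 < A -> 0 < eps ->
  (forall k, (k < n)%N -> 0 < M k k) ->
  (forall k j, (k < j < n)%N -> M k j = 0) ->
  (forall k, (k < n)%N -> f k = \sum_(j < n) M k j *: e j) ->
  (forall t u : coord R n, sqdist t u <= (A * `|lincomb e t - lincomb e u|) ^+ 2) ->
  (forall a : nat -> R, \sum_(k < n) `|a k| < 1 ->
     exists i, ball (c i) eps (\sum_(k < n) a k *: f k)) ->
  \prod_(k < n) M k k <= n`!%:R * ball_volume n * (A * eps) ^+ n.
Proof.
move=> A0 eps0 Mpos Mtrig fM sqdistA cover.
have Ae0 : 0 < A * eps by rewrite mulr_gt0.
have P0 : 0 <= \prod_(k < n) M k k by rewrite prodr_ge0// => k _; exact/ltW/Mpos.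
have nf0 : 0 < n`!%:R :> R by rewrite ltr0n fact_gt0.
rewrite mulrAC -ler_pdivrMl ?mulr_gt0 ?exprn_gt0//.
apply: le_ball_volume => [|u u0].
  by rewrite mulr_ge0// invr_ge0 mulr_ge0 ?exprn_ge0// ltW.
(* The scale at which the pieces of the covering have Euclidean diameter at most
   [2 * Num.sqrt u]. *)
pose s := Num.sqrt u / (A * eps).
have s0 : 0 < s by rewrite divr_gt0 ?sqrtr_gt0.
have s2 : (A * (s * eps)) ^+ 2 = u.
  rewrite (_ : A * (s * eps) = Num.sqrt u) ?sqr_sqrtr ?ltW//.
  by rewrite mulrCA /s divfK ?gt_eqF.
pose W (i : nat) : set (coord R n) :=
  if insub i is Some j then [set t | `|- (s *: c j) + lincomb e t| < s * eps] else set0.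
have mW i : measurable (W i).
  by rewrite /W; case: insubP => [j _ _|_]; [exact: measurable_norm_lincomb_lt|].
have volW i : (vol n (W i) <= vol n [set t | (sqnorm t < u)%R])%E.
  apply: isodiametric => // t v; rewrite /W; case: insubP => //= j _ _ tj vj.
  apply: le_lt_trans (sqdistA _ _) _.
  have tv : `|lincomb e t - lincomb e v| < 2 * (s * eps).
    rewrite (_ : _ - _ = (- (s *: c j) + lincomb e t) - (- (s *: c j) + lincomb e v)).
      by rewrite (le_lt_trans (ler_normB _ _))//; lra.
    by rewrite opprD opprK addrACA addNr add0r.
  have -> : 4 * u = (A * (2 * (s * eps))) ^+ 2 by rewrite -s2; ring.
  have Atv : A * `|lincomb e t - lincomb e v| < A * (2 * (s * eps)) by rewrite ltr_pM2l.
  have Atv0 : 0 <= A * `|lincomb e t - lincomb e v| by rewrite mulr_ge0// ltW.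
  by rewrite ltr_pXn2r// nnegrE// (le_trans Atv0)// ltW.
have mU : measurable (\big[setU/set0]_(i < 2 ^ n) W i).
  by apply: bigsetU_measurable.
have := @crosspolytope_vol R n M _ s (fun=> 0) mU s0 Mpos Mtrig.
have H : forall a : nat -> R, \sum_(k < n) `|a k| < s ->
  (\big[setU/set0]_(i < 2 ^ n) W i) (of_coords n (fun j => 0 + \sum_(k < n) a k * M k j)).
  move=> a a_s; have := cover (fun k => s^-1 * a k).
  case=> [|i].
    under eq_bigr do rewrite normrM gtr0_norm ?invr_gt0//.
    by rewrite -mulr_sumr ltr_pdivrMl// mulr1.
  rewrite -ball_normE/= => ci.
  rewrite -bigcup_mkord; exists i => //=; rewrite /W.
  case: insubP => [j _ ji|]; last by rewrite ltn_ord.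
  have {j ji}-> : j = i by exact/val_inj.
  rewrite /= lincomb_of_coords.
  rewrite (_ : \sum_(j < n) _ = s *: \sum_(k < n) (s^-1 * a k) *: f k).
    by rewrite addrC -scalerBr normrZ gtr0_norm// ltr_pM2l// distrC.
  rewrite scaler_sumr; under [RHS]eq_bigr => k _.
    rewrite scalerA mulVKf ?gt_eqF// fM// scaler_sumr.
    over.
  rewrite exchange_big/=; apply: eq_bigr => j _; rewrite add0r scaler_suml.
  by apply: eq_bigr => k _; rewrite scalerA.
move/(_ H) => {H}.
have := Boole_inequality (vol n) (A := W) (n := 2 ^ n) (fun i _ => mW i).
move=> volU /le_trans /(_ volU) {volU}.
have sumW : (\sum_(i < 2 ^ n) vol n (W i) <= \sum_(i < 2 ^ n) vol n [set t | (sqnorm t < u)%R])%E.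
  by apply: lee_sum => i _.
move=> /le_trans /(_ sumW) {sumW}.
have : (0 <= vol n [set t | (sqnorm t < u)%R])%E by exact: measure_ge0.
case: (vol n [set t | (sqnorm t < u)%R])%E => [v| |] //=; last first.
  by move=> _ _; rewrite leey.
rewrite lee_fin => v0.
rewrite sumEFin !lee_fin sumr_const card_ord -[v *+ _]mulr_natl natrX exprMn.
rewrite -2!mulrA ler_pM2l ?exprn_gt0//.
apply: le_trans; rewrite le_eqVlt; apply/orP; left; apply/eqP.
by rewrite /s expr_div_n; field; rewrite ?expf_neq0 ?gt_eqF.
Qed.

End Covering.

(** * Linear spans *)

Section Spans.
Context {R : realType} {V : lmodType R}.
Implicit Types (F : nat -> V) (n m : nat) (x y : V).

(** Coefficients are indexed by all of [nat] so that prefixes of one family can be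
    compared without casts between ordinal types. *)
Definition fspan F n : set V :=
  [set x | exists c : nat -> R, x = \sum_(j < n) c j *: F j].

Lemma fspan0 F n : fspan F n 0.
Proof. by exists (fun=> 0); rewrite big1// => j _; rewrite scale0r. Qed.

Lemma fspanP F n (a : R) x y : fspan F n x -> fspan F n y -> fspan F n (a *: x + y).
Proof.
move=> [c ->] [d ->]; exists (fun j => a * c j + d j).
rewrite scaler_sumr -big_split/=; apply: eq_bigr => j _.
by rewrite scalerDl scalerA.
Qed.

Lemma fspanZ F n (a : R) x : fspan F n x -> fspan F n (a *: x).
Proof. by move=> Fx; rewrite -[_ *: _]addr0; apply: fspanP => //; exact: fspan0. Qed.

Lemma fspanD F n x y : fspan F n x -> fspan F n y -> fspan F n (x + y).
Proof. by move=> Fx Fy; rewrite -[x]scale1r; exact: fspanP. Qed.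

Lemma fspanB F n x y : fspan F n x -> fspan F n y -> fspan F n (x - y).
Proof. by move=> Fx Fy; rewrite -scaleN1r addrC; exact: fspanP. Qed.

Lemma fspan_sum F n m (c : nat -> R) (G : nat -> V) :
  (forall j, (j < m)%N -> fspan F n (G j)) -> fspan F n (\sum_(j < m) c j *: G j).
Proof.
elim: m => [|m IH] FG; first by rewrite big_ord0; exact: fspan0.
rewrite big_ord_recr/= addrC; apply: fspanP; first exact: FG.
by apply: IH => j jm; apply: FG; exact: ltnW.
Qed.

Lemma mem_fspan F n j : (j < n)%N -> fspan F n (F j).
Proof.
move=> jn; exists (fun k => (k == j)%:R).
rewrite (bigD1 (Ordinal jn))//= eqxx scale1r big1 ?addr0// => i.
by rewrite -val_eqE/= => /negbTE ->; rewrite scale0r.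
Qed.

Lemma fspanS F n m x : (n <= m)%N -> fspan F n x -> fspan F m x.
Proof.
move=> nm [c ->]; apply: fspan_sum => j jn.
by apply: mem_fspan; exact: leq_trans nm.
Qed.

Lemma lspan_range F n : lspan (range (fun i : 'I_n => F i)) = fspan F n.
Proof.
apply/seteqP; split => [x [m [c [a [aF ->]]]]|x [c ->]].
  elim/big_ind: _ => [|y z|i _]; [exact: fspan0|exact: fspanD|].
  by apply: fspanZ; have [k _ <-] := aF i; exact: mem_fspan.
by exists n, (fun i => c i), (fun i => F i); split => // i; exists i.
Qed.

Lemma lspan0 (A : set V) : lspan A 0.
Proof.
exists 0%N, (fun=> 0), (fun=> 0); split; last by rewrite big_ord0.
by case.
Qed.

Lemma lspan_lin (A : set V) (a : R) x y :
  lspan A x -> lspan A y -> lspan A (a *: x + y).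
Proof.
move=> [m [c [u [Au ->]]]] [p [d [v [Av ->]]]].
exists (m + p)%N, (fun i => match fintype.split i with inl j => a * c j | inr j => d j end),
  (fun i => match fintype.split i with inl j => u j | inr j => v j end); split.
  by move=> i; case: fintype.split.
rewrite big_split_ord/= scaler_sumr; congr (_ + _); apply: eq_bigr => i _.
  by rewrite (unsplitK (inl i)) scalerA.
by rewrite (unsplitK (inr i)).
Qed.

Lemma mem_lspan (A : set V) x : A x -> lspan A x.
Proof.
move=> Ax; exists 1%N, (fun=> 1), (fun=> x); split => //.
by rewrite big_ord1 scale1r.
Qed.

Lemma lspan_sum (A : set V) n (c : 'I_n -> R) (u : 'I_n -> V) :
  (forall j, lspan A (u j)) -> lspan A (\sum_(j < n) c j *: u j).
Proof.
move=> Au; elim/big_ind: _ => [|x y Ax Ay|j _]; first exact: lspan0.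
  by rewrite -[x]scale1r; exact: lspan_lin.
by rewrite -[_ *: _]addr0; apply: lspan_lin => //; exact: lspan0.
Qed.

Lemma fspan_lspan (A : set V) F n x :
  (forall j, (j < n)%N -> lspan A (F j)) -> fspan F n x -> lspan A x.
Proof. by move=> AF [c ->]; apply: lspan_sum => j; exact: AF. Qed.

Lemma fspan_ord F n (c : 'I_n -> R) :
  fspan F n (\sum_(j < n) c j *: F j).
Proof.
elim/big_ind: _ => [|x y|j _]; [exact: fspan0|exact: fspanD|].
by apply: fspanZ; exact: mem_fspan.
Qed.

Lemma fspan_trans F F' n x :
  (forall j, (j < n)%N -> fspan F' n (F j)) -> fspan F n x -> fspan F' n x.
Proof. by move=> FF' [c ->]; exact: fspan_sum. Qed.

Lemma linear_on_sum {W : lmodType R} (A : set V) (h : V -> W) n (c : 'I_n -> R) (u : 'I_n -> V) :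
  linear_on (lspan A) h -> (forall j, lspan A (u j)) ->
  h (\sum_(j < n) c j *: u j) = \sum_(j < n) c j *: h (u j).
Proof.
move=> hlin Su.
have h0 : h 0 = 0.
  have := hlin 1 0 0 (lspan0 A) (lspan0 A); rewrite !scale1r addr0 => /eqP.
  by rewrite -subr_eq0 opprD addNKr oppr_eq0 => /eqP.
elim: n c u Su => [|n IH] c u Su; first by rewrite !big_ord0.
rewrite !big_ord_recl hlin ?IH//; last by apply: lspan_sum => j; exact: Su.
Qed.

End Spans.

Section XspanE.
Context {R : realType} {X : completeNormedModType R}.

Lemma Xspan_fspan (f : nat -> X) n : Xspan f n = fspan (fun j => f j.+1) n.
Proof.
rewrite -lspan_range /Xspan; congr lspan; apply/seteqP; split => x.
  by move=> [[|k] /andP[_ kn] <-]//; exists (Ordinal kn).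
by move=> [[k kn] _ <-]; exists k.+1.
Qed.

End XspanE.

(** * Gram-Schmidt orthogonalisation *)

Section GramSchmidt.
Context {R : realType} {V : lmodType R}.
Variables (F : nat -> V) (D : set V) (form : V -> V -> R).
Hypothesis D_lin : forall (a : R) x y, D x -> D y -> D (a *: x + y).
Hypothesis form_lin : forall (a : R) x y z, D x -> D y -> D z ->
  form (a *: x + y) z = a * form x z + form y z.
Hypothesis formC : forall x y, form x y = form y x.
Hypothesis form_gt0 : forall x, D x -> x != 0 -> 0 < form x x.

Lemma form_sum n (c : nat -> R) (e : nat -> V) z : D z -> D 0 ->
  (forall j, (j < n)%N -> D (e j)) ->
  D (\sum_(j < n) c j *: e j) /\
  form (\sum_(j < n) c j *: e j) z = \sum_(j < n) c j * form (e j) z.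
Proof.
move=> Dz D0; elim: n => [|n IH] De.
  rewrite !big_ord0; split=> //.
  by have := form_lin 1 D0 D0 Dz; rewrite scaler0 addr0 mul1r; lra.
have [|Ds IH'] := IH; first by move=> j jn; apply: De; exact: ltnW.
rewrite !big_ord_recr/= ![_ + c n *: _]addrC.
have Den : D (e n) by exact: De.
by split; [exact: D_lin | rewrite form_lin// IH' addrC].
Qed.

(** The form is positive definite only on [D]: it is the pull-back of the
    Euclidean scalar product by a map that is linear on [D] alone.  Orthogonality
    turns the coefficients of [F k] into [form (F k) (e j)], and keeping [e k] in
    the span of the first [k + 1] vectors makes the system triangular. *)
Lemma gram_schmidt n : D 0 -> (forall k, (k < n)%N -> D (F k)) ->
  (forall k, (k < n)%N -> ~ fspan F k (F k)) ->
  exists e : nat -> V, [/\ forall k, (k < n)%N -> D (e k),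
    forall k, (k < n)%N -> fspan F k.+1 (e k),
    forall i j, (i < n)%N -> (j < n)%N -> form (e i) (e j) = (i == j)%:R &
    forall k, (k < n)%N -> 0 < form (F k) (e k) /\
      F k = \sum_(j < k.+1) form (F k) (e j) *: e j].
Proof.
move=> D0; elim: n => [|n IH] DF indep; first by exists (fun=> 0).
have [||e [De Fe eON FE]] := IH.
- by move=> k kn; apply: DF; exact: ltnW.
- by move=> k kn; apply: indep; exact: ltnW.
pose p := \sum_(j < n) form (F n) (e j) *: e j.
have Dp : D p by have [] := form_sum (fun j => form (F n) (e j)) (DF n (ltnSn n)) D0 De.
have formp j : (j < n)%N -> form p (e j) = form (F n) (e j).
  move=> jn; have [_ ->] := form_sum (fun j => form (F n) (e j)) (De _ jn) D0 De.
  rewrite (bigD1 (Ordinal jn))//= eON// eqxx mulr1 big1 ?addr0// => i.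
  by rewrite -val_eqE/= => /negbTE ij; rewrite eON// ij mulr0.
pose w := F n - p.
have DFn : D (F n) by exact: DF.
have Dw : D w by rewrite /w -scaleN1r addrC; exact: D_lin.
have w0 : w != 0.
  rewrite subr_eq0; apply/eqP => Fp; apply: (indep n (ltnSn n)); rewrite Fp.
  rewrite /p; apply: (@fspan_sum _ _ F n n (fun j => form (F n) (e j)) e) => j jn.
  by apply: (fspanS (n := j.+1)) => //; exact: Fe.
have we j : (j < n)%N -> form w (e j) = 0.
  move=> jn; rewrite /w addrC -scaleN1r (form_lin _ Dp DFn (De _ jn)) formp//.
  by rewrite mulN1r addNr.
pose nu := Num.sqrt (form w w).
have nu0 : 0 < nu by rewrite sqrtr_gt0 form_gt0.
have nu2 : form w w = nu ^+ 2 by rewrite sqr_sqrtr// ltW// form_gt0.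
pose u := nu^-1 *: w.
have formZ (a : R) x z : D x -> D z -> form (a *: x) z = a * form x z.
  move=> Dx Dz; rewrite -[_ *: _]addr0 form_lin//.
  have := form_lin 1 D0 D0 Dz; rewrite scaler0 addr0 mul1r; lra.
have Du : D u by rewrite /u -[_ *: _]addr0; exact: D_lin.
have uu : form u u = 1.
  by rewrite /u formZ// formC formZ// nu2; field; rewrite gt_eqF.
have ue j : (j < n)%N -> form u (e j) = 0.
  by move=> jn; rewrite /u (formZ _ _ _ Dw (De _ jn)) we// mulr0.
have Fnu : form (F n) u = nu.
  have -> : F n = 1 *: w + p by rewrite scale1r subrK.
  rewrite form_lin// mul1r.
  have [_ ->] := form_sum (fun j => form (F n) (e j)) Du D0 De.
  rewrite big1 ?addr0 => [|j _]; last by rewrite [form (e j) u]formC ue ?mulr0.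
  by rewrite formC /u formZ// nu2; field; rewrite gt_eqF.
pose e' k := if k == n then u else e k.
have e'n : e' n = u by rewrite /e' eqxx.
have e'E k : (k < n)%N -> e' k = e k by rewrite /e'; case: eqP => // ->; rewrite ltnn.
have split_lt (P : nat -> Prop) : P n -> (forall k, (k < n)%N -> P k) ->
    forall k, (k < n.+1)%N -> P k.
  by move=> Pn Pk k; rewrite ltnS leq_eqVlt => /predU1P[->|/Pk].
exists e'; split.
- by apply: (split_lt _) => [|k kn]; rewrite ?e'n// e'E//; exact: De.
- apply: (split_lt _) => [|k kn]; last by rewrite e'E//; exact: Fe.
  rewrite e'n; apply: fspanZ; apply: fspanB; first exact: mem_fspan.
  apply: (@fspan_sum _ _ F n.+1 n (fun j => form (F n) (e j)) e) => j jn.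
  by apply: fspanS (Fe _ jn); exact: ltnW.
- move=> i j; move: i; apply: (split_lt _) => [|i iin]; move: j; apply: (split_lt _) => [|j jn].
  + by rewrite e'n eqxx.
  + by rewrite e'n e'E// ue// gtn_eqF.
  + by rewrite e'n e'E// formC ue// ltn_eqF.
  + by rewrite !e'E// eON.
- apply: (split_lt _) => [|k kn].
    rewrite e'n Fnu; split=> //; rewrite big_ord_recr/= e'n Fnu.
    rewrite scalerA mulfV ?gt_eqF// scale1r.
    under eq_bigr => j _ do rewrite e'E//.
    by rewrite -/p addrC subrK.
  have [? FkE] := FE _ kn; rewrite e'E//; split=> //.
  rewrite [LHS]FkE; apply: eq_bigr => j _; rewrite e'E//.
  by apply: leq_trans kn; exact: ltn_ord.
Qed.

End GramSchmidt.

(** * Operator norms, the Euclidean norm and isomorphisms *)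

Section OpNorm.
Context {R : realType} {U V : lmodType R}.
Variables (D : set U) (nU : U -> R) (nV : V -> R) (A : U -> V).

Lemma op_norm_ge0 : (0 <= op_norm D nU nV A)%E.
Proof. by rewrite /op_norm /sup_ge0 le_max lexx. Qed.

Lemma le_op_norm (a : R) u : op_norm D nU nV A = a%:E -> D u -> u <> 0 ->
  0 < nU u -> nV (A u) <= a * nU u.
Proof.
move=> aE Du u0 nu0; rewrite -ler_pdivrMr// -lee_fin -aE /op_norm /sup_ge0.
by rewrite le_max; apply/orP; right; apply: ereal_sup_ubound; exists u.
Qed.

Lemma op_norm_fin (b : R) : 0 <= b ->
  (forall u, D u -> u <> 0 -> 0 < nU u /\ nV (A u) <= b * nU u) ->
  exists2 a, 0 <= a & op_norm D nU nV A = a%:E.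
Proof.
move=> b0 AD.
have : (op_norm D nU nV A <= b%:E)%E.
  rewrite /op_norm /sup_ge0 ge_max lee_fin b0/=; apply: ge_ereal_sup => _ [u [Du u0] <-].
  by rewrite lee_fin; have [nu0 ?] := AD _ Du u0; rewrite ler_pdivrMr.
have := op_norm_ge0; case: (op_norm _ _ _ _) => [a| |]//=.
by rewrite lee_fin => a0 _; exists a.
Qed.

End OpNorm.

Section Euclid.
Context {R : realType} {n : nat}.
Implicit Types u v : 'rV[R]_n.

Definition dotv u v : R := \sum_(i < n) u 0 i * v 0 i.

Lemma dotvC u v : dotv u v = dotv v u.
Proof. by apply: eq_bigr => i _; rewrite mulrC. Qed.

Lemma dotv_lin (a : R) u v w : dotv (a *: u + v) w = a * dotv u w + dotv v w.
Proof.
rewrite /dotv mulr_sumr -big_split/=; apply: eq_bigr => i _.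
by rewrite !mxE; ring.
Qed.

Lemma dotvv u : dotv u u = l2norm u ^+ 2.
Proof.
rewrite /l2norm sqr_sqrtr; last by apply: sumr_ge0 => i _; exact: sqr_ge0.
by apply: eq_bigr => i _; rewrite expr2.
Qed.

Lemma l2norm_ge0 u : 0 <= l2norm u. Proof. exact: sqrtr_ge0. Qed.

Lemma ler_l2norm u i : `|u 0 i| <= l2norm u.
Proof.
rewrite -ler_sqr ?nnegrE ?l2norm_ge0// real_normK ?num_real// -dotvv /dotv.
rewrite (bigD1 i)//= -expr2 lerDl sumr_ge0// => j _.
by rewrite -expr2 sqr_ge0.
Qed.

Lemma l2norm_gt0 u : u <> 0 -> 0 < l2norm u.
Proof.
move=> u0; rewrite lt_neqAle l2norm_ge0 andbT eq_sym; apply/eqP => l0; apply: u0.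
apply/rowP => i; rewrite mxE; apply/normr0_eq0.
by apply/eqP; rewrite eq_le normr_ge0 andbT -l0 ler_l2norm.
Qed.

Lemma l2norm_le (b : R) u : 0 <= b -> (forall i, `|u 0 i| <= b) -> l2norm u <= n%:R * b.
Proof.
move=> b0 ub; rewrite -ler_sqr ?nnegrE ?l2norm_ge0 ?mulr_ge0// -dotvv.
apply: (@le_trans _ _ (\sum_(i < n) b ^+ 2)).
  apply: ler_sum => i _; rewrite -expr2 -real_normK ?num_real//.
  by rewrite ler_sqr ?nnegrE.
rewrite sumr_const card_ord -[_ *+ n]mulr_natl exprMn ler_wpM2r ?sqr_ge0//.
by rewrite -natrX ler_nat; case: (n) => // k; rewrite leq_pmulr.
Qed.

End Euclid.

Section LinearIso.
Context {R : realType} {X : lmodType R} (n : nat).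
Variables (D : set X) (T : X -> 'rV[R]_n) (Ti : 'rV[R]_n -> X).
Hypothesis D_lin : forall (a : R) x y, D x -> D y -> D (a *: x + y).
Hypothesis iso : linear_iso D T Ti.

Lemma linear_iso_dom0 : D 0.
Proof.
have [_ _ TiK] := iso; have [D0 _] := TiK 0.
by have := D_lin (-1) D0 D0; rewrite scaleN1r addNr.
Qed.

Lemma linear_iso0 : T 0 = 0.
Proof.
have [Tl _ _] := iso.
have := Tl 1 0 0 linear_iso_dom0 linear_iso_dom0; rewrite !scale1r addr0 => /eqP.
by rewrite -subr_eq0 opprD addNKr oppr_eq0 => /eqP.
Qed.

Lemma linear_iso_eq0 x : D x -> T x = 0 -> x = 0.
Proof.
have [_ TK _] := iso => Dx Tx.
by rewrite -(TK _ Dx) Tx -linear_iso0 TK//; exact: linear_iso_dom0.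
Qed.

End LinearIso.

(** * Distances and coverings through one isomorphism *)

Section CoreBound.
Context {R : realType} {X : completeNormedModType R}.
Local Notation nrm := (fun x : X => `|x|).
Implicit Types (F f : nat -> X) (tau : nat -> R).

Lemma of_coords_surj n (t : coord R n) : exists a, t = of_coords n a.
Proof.
elim: n t => [|n IH] /=; first by case; exists (fun=> 0).
move=> [x t]; have [a ->] := IH t.
exists (fun j => if (j < n)%N then a j else x); rewrite ltnn; congr pair.
have : forall m, (m <= n)%N -> of_coords m a = of_coords m (fun j => if (j < n)%N then a j else x).
  by elim=> //= m IHm mn; rewrite mn IHm// ltnW.
exact.
Qed.

Lemma sqdist_of_coords n (a b : nat -> R) :
  sqdist (of_coords n a) (of_coords n b) = \sum_(j < n) (a j - b j) ^+ 2.
Proof.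
by elim: n => [|n IH] /=; rewrite ?big_ord0// big_ord_recr IH addrC.
Qed.

Lemma dist_le (x y : X) (Y : set X) : Y y -> dist x Y <= `|x - y|.
Proof.
move=> Yy; apply: ge_inf; last by exists y.
by exists 0 => _ [z _ <-].
Qed.

Lemma dist_ge (x : X) (Y : set X) (r : R) : Y !=set0 ->
  (forall y, Y y -> r <= `|x - y|) -> r <= dist x Y.
Proof.
move=> [y0 Yy0] rY; apply: lb_le_inf; first by exists `|x - y0|, y0.
by move=> _ [y Yy <-]; exact: rY.
Qed.

Lemma notin_fspan F k (tau : R) : 0 < tau -> tau <= dist (F k) (fspan F k) ->
  ~ fspan F k (F k).
Proof. by move=> t0 tF /(@dist_le (F k)); rewrite subrr normr0; lra. Qed.

Lemma hull_comb (K : set X) F n (a : nat -> R) :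
  (forall k, (k < n)%N -> K (F k)) -> \sum_(k < n) `|a k| < 1 ->
  sym_hull K (\sum_(k < n) a k *: F k).
Proof.
move=> KF a1; apply: subset_closure.
exists n, (fun i => a i), (fun i => F i); split => //; first exact: ltW.
by move=> i; exact: KF.
Qed.

(** Orthogonalise the [F k] for the Euclidean structure pulled back by [T].  Then
    [F k] differs from a positive multiple of [e k] by an element of the span of
    its predecessors; the factor, which is the [k]-th height of the image of the
    cross-polytope, is at least [tau k / b] because [e k] has norm at most [b]. *)
Lemma iso_volume_bound n K F tau (T : X -> 'rV[R]_n) Ti (a b eps : R)
    (c : 'I_(2 ^ n) -> X) :
  (0 < n)%N ->
  (forall k, (k < n)%N -> K (F k)) ->
  (forall k, (k < n)%N -> 0 < tau k <= dist (F k) (fspan F k)) ->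
  linear_iso (fspan F n) T Ti ->
  op_norm (fspan F n) nrm l2norm T = a%:E ->
  op_norm setT l2norm nrm Ti = b%:E ->
  0 < eps -> sym_hull K `<=` \bigcup_i ball (c i) eps ->
  \prod_(k < n) tau k <= n`!%:R * ball_volume n * (a * b * eps) ^+ n.
Proof.
move=> n0 KF tauF iso Ta Tib eps0 cover.
pose D := fspan F n.
have D0 : D 0 by exact: fspan0.
have D_lin (r : R) x y : D x -> D y -> D (r *: x + y) by exact: fspanP.
have [Tl TK TiK] := iso.
pose form x y := dotv (T x) (T y).
have DF k : (k < n)%N -> D (F k) by exact: mem_fspan.
have form_lin (r : R) x y z : D x -> D y -> D z ->
    form (r *: x + y) z = r * form x z + form y z.
  by move=> Dx Dy Dz; rewrite /form Tl// dotv_lin.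
have formC x y : form x y = form y x by exact: dotvC.
have form_gt0 x : D x -> x != 0 -> 0 < form x x.
  move=> Dx x0; rewrite /form dotvv exprn_gt0// l2norm_gt0// => Tx.
  by move/eqP: x0; apply; exact: linear_iso_eq0 iso x Dx Tx.
have indep k : (k < n)%N -> ~ fspan F k (F k).
  by move=> /tauF /andP[t0 tF]; exact: notin_fspan tF.
have [e [De Fe eON FE]] := gram_schmidt D_lin form_lin formC form_gt0 D0 DF indep.
have le2 k : (k < n)%N -> l2norm (T (e k)) = 1.
  move=> kn; have := eON k k kn kn; rewrite eqxx /form dotvv => /eqP.
  by rewrite sqrp_eq1 ?l2norm_ge0// => /eqP.
have e_neq0 k : (k < n)%N -> e k <> 0.
  move=> kn ek; have := eON k k kn kn.
  rewrite eqxx ek /form (linear_iso0 D_lin iso) dotvv.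
  rewrite /l2norm big1 ?sqrtr0 ?expr0n/= => [/eqP|i _]; last by rewrite mxE expr0n.
  by rewrite eq_sym oner_eq0.
have Tx x : D x -> l2norm (T x) <= a * `|x|.
  move=> Dx; have [->|/eqP x0] := eqVneq x 0.
    rewrite (linear_iso0 D_lin iso) normr0 mulr0 /l2norm big1 ?sqrtr0// => i _.
    by rewrite mxE expr0n.
  by apply: (le_op_norm Ta) => //; rewrite normr_gt0; exact/eqP.
have a0 : 0 < a.
  have := Tx (e 0%N) (De _ n0); rewrite le2// => ae.
  rewrite ltNge; apply/negP => a_le0.
  by have := mulr_le0_ge0 a_le0 (normr_ge0 (e 0%N)); lra.
have e_le k : (k < n)%N -> `|e k| <= b.
  move=> kn; have Tek0 : T (e k) <> 0.
    by move=> Tek; apply: (e_neq0 _ kn); exact: linear_iso_eq0 iso _ (De _ kn) Tek.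
  have := le_op_norm Tib I Tek0; rewrite le2// mulr1 TK; last exact: De.
  by apply.
pose M k j := if (j <= k)%N then form (F k) (e j) else 0.
have Mkk k : M k k = form (F k) (e k) by rewrite /M leqnn.
have Mpos k : (k < n)%N -> 0 < M k k by rewrite Mkk => /FE[].
have tauM k : (k < n)%N -> tau k <= M k k * b.
  move=> kn; have /andP[t0 tF] := tauF _ kn; apply: le_trans tF _.
  have [_ FkE] := FE _ kn.
  pose p := \sum_(j < k) form (F k) (e j) *: e j.
  have Fp : fspan F k p.
    apply: (@fspan_sum _ _ F k k (fun j => form (F k) (e j)) e) => j jk.
    by apply: fspanS (Fe _ (ltn_trans jk kn)).
  apply: le_trans (dist_le _ Fp) _.
  have -> : F k - p = M k k *: e k.
    by rewrite {1}FkE big_ord_recr/= -/p Mkk [p + _]addrC addrK.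
  by rewrite normrZ gtr0_norm ?Mpos// ler_wpM2l ?e_le// ltW// Mpos.
have FM k : (k < n)%N -> F k = \sum_(j < n) M k j *: e j.
  move=> kn; have [_ {1}->] := FE _ kn.
  rewrite (big_ord_widen n (fun j => form (F k) (e j) *: e j))// big_mkcond/=.
  by apply: eq_bigr => j _; rewrite /M ltnS; case: ifP => _; rewrite ?scale0r.
have b0 : 0 <= b by apply: le_trans (e_le _ n0).
have eDD (u : nat -> R) : D (\sum_(j < n) u j *: e j).
  by apply: fspan_sum => j jn; exact: De.
have formE (u : nat -> R) z : D z ->
    form (\sum_(j < n) u j *: e j) z = \sum_(j < n) u j * form (e j) z.
  move=> Dz.
  by have [] := form_sum D_lin form_lin u Dz D0 De.
have MV : \prod_(k < n) M k k <= n`!%:R * ball_volume n * (a * eps) ^+ n.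
  apply: (@prod_le_ball_volume R X n e F M a eps c) => //.
  - by move=> k j /andP[kj _]; rewrite /M leqNgt kj.
  - move=> t u; have [v ->] := of_coords_surj t; have [w ->] := of_coords_surj u.
    rewrite sqdist_of_coords !lincomb_of_coords -sumrB.
    pose x := \sum_(j < n) (v j - w j) *: e j.
    have -> : \sum_(j < n) (v j *: e j - w j *: e j) = x.
      by apply: eq_bigr => j _; rewrite scalerBl.
    have Dx : D x by exact: (eDD (fun j => v j - w j)).
    have -> : \sum_(j < n) (v j - w j) ^+ 2 = l2norm (T x) ^+ 2.
      rewrite -dotvv -/(form x x) {1}/x (formE (fun j => v j - w j))//.
      apply: eq_bigr => j _; rewrite expr2 /form dotvC -/(form x (e j)).
      rewrite /x (formE (fun j => v j - w j)); last exact: De.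
      rewrite (bigD1 j)//= eON// eqxx mulr1 big1 ?addr0// => i ij.
      by rewrite eON// (_ : (i == j :> nat) = false) ?mulr0//; apply/negbTE.
    by rewrite ler_sqr ?nnegrE ?l2norm_ge0 ?mulr_ge0 ?Tx// ltW.
  - move=> u u1; have /cover[i _ ci] := hull_comb KF u1.
    by exists i.
have MB : \prod_(k < n) tau k <= \prod_(k < n) (M k k * b).
  apply: ler_prod => k _; rewrite tauM// andbT.
  by have /andP[/ltW] := tauF _ (ltn_ord k).
apply: (le_trans MB); rewrite big_split/= prodr_const card_ord.
apply: (le_trans (ler_wpM2r (exprn_ge0 n b0) MV)).
by rewrite !exprMn le_eqVlt; apply/orP; left; apply/eqP; ring.
Qed.

End CoreBound.

(** * An isomorphism with finite norms *)

Section FiniteIso.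
Context {R : realType} {X : completeNormedModType R}.
Local Notation nrm := (fun x : X => `|x|).
Variables (F : nat -> X) (tau : nat -> R).

(** The last coefficient is controlled by the distance of the last vector to the
    span of the others; subtracting the last term reduces to one vector less. *)
Lemma coord_bounded n : (forall k, (k < n)%N -> 0 < tau k <= dist (F k) (fspan F k)) ->
  exists2 C, 0 <= C & forall (c : nat -> R) k, (k < n)%N ->
    `|c k| <= C * `|\sum_(j < n) c j *: F j|.
Proof.
elim: n => [|n IH] tauF; first by exists 0.
have [|C C0 Cc] := IH; first by move=> k kn; apply: tauF; exact: ltnW.
have /andP[t0 tF] := tauF n (ltnSn n).
pose t := tau n.
have last_le (c : nat -> R) : `|c n| <= t^-1 * `|\sum_(j < n.+1) c j *: F j|.
  have [->|cn0] := eqVneq (c n) 0; first by rewrite normr0 mulr_ge0// invr_ge0 ltW.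
  rewrite ler_pdivlMl// big_ord_recr/=.
  set s := \sum_(j < n) _.
  have -> : s + c n *: F n = c n *: (F n - (- (c n)^-1) *: s).
    by rewrite scalerBr scalerA mulrN mulfV// scaleN1r opprK addrC.
  rewrite normrZ mulrC ler_wpM2l//; apply: (le_trans tF); apply: dist_le.
  by apply: fspanZ; exists c.
(* The coefficient [c n] is at most [t^-1] times the norm of the sum; removing
   its term multiplies this norm by at most [1 + t^-1 * `|F n|]. *)
pose C' := t^-1 + C * (1 + t^-1 * `|F n|).
have C'0 : 0 <= t^-1 by rewrite invr_ge0 ltW.
have C2 : 0 <= C * (1 + t^-1 * `|F n|) by rewrite mulr_ge0 ?addr_ge0 ?mulr_ge0.
exists C' => [|c k]; first by rewrite addr_ge0.
rewrite ltnS leq_eqVlt => /predU1P[->|kn].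
  by apply: (le_trans (last_le c)); rewrite ler_wpM2r// lerDl.
apply: (le_trans (Cc c k kn)).
apply: (@le_trans _ _ (C * (1 + t^-1 * `|F n|) * `|\sum_(j < n.+1) c j *: F j|)); last first.
  by rewrite ler_wpM2r// lerDr.
rewrite -mulrA ler_wpM2l// mulrDl mul1r.
rewrite {1}(_ : \sum_(j < n) c j *: F j = \sum_(j < n.+1) c j *: F j - c n *: F n); last first.
  by rewrite big_ord_recr/= addrK.
apply: (le_trans (ler_normB _ _)); rewrite lerD2l normrZ mulrAC.
by rewrite ler_wpM2r// last_le.
Qed.

(** One isomorphism with finite norms is enough to show that the entropy number
    is positive; without it the right-hand side of the final bound could be a
    product of [0] and [+oo]. *)
Lemma finite_iso_exists n :
  (forall k, (k < n)%N -> 0 < tau k <= dist (F k) (fspan F k)) ->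
  exists (T : X -> 'rV[R]_n) (Ti : 'rV[R]_n -> X) (a b : R),
  [/\ linear_iso (fspan F n) T Ti, op_norm (fspan F n) nrm l2norm T = a%:E &
      op_norm setT l2norm nrm Ti = b%:E].
Proof.
move=> tauF; have [C C0 Cc] := coord_bounded tauF.
pose Ti (v : 'rV[R]_n) : X := \sum_(j < n) v 0 j *: F j.
pose nat_row (v : 'rV[R]_n) (j : nat) : R := if insub j is Some i then v 0 i else 0.
have nat_rowE v (i : 'I_n) : nat_row v i = v 0 i.
  by rewrite /nat_row insubT//= => ?; congr (v 0 _); exact: val_inj.
have TiE v : Ti v = \sum_(j < n) nat_row v j *: F j.
  by apply: eq_bigr => j _; rewrite nat_rowE.
have Ti_lin : linear_on setT Ti.
  move=> r x y _ _; rewrite /Ti scaler_sumr -big_split/=.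
  by apply: eq_bigr => j _; rewrite !mxE scalerDl scalerA.
have Ti_D v : fspan F n (Ti v) by rewrite TiE; exists (nat_row v).
have Ti_bd (v : 'rV[R]_n) i : `|v 0 i| <= C * `|Ti v|.
  by rewrite TiE -nat_rowE; exact: Cc.
have Ti_inj v : Ti v = 0 -> v = 0.
  move=> Tv; apply/rowP => i; rewrite mxE; apply/normr0_eq0/eqP.
  by rewrite eq_le normr_ge0 andbT; have := Ti_bd v i; rewrite Tv normr0 mulr0.
pose T x := xget 0 [set v | x = Ti v].
have TK x : fspan F n x -> x = Ti (T x).
  move=> [c xc]; suff : [set v | x = Ti v] (T x) by [].
  apply: xgetPex; exists (\row_i c i).
  by rewrite /= xc; apply: eq_bigr => j _; rewrite mxE.
have TiK v : T (Ti v) = v.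
  apply/eqP; rewrite -subr_eq0; apply/eqP; apply: Ti_inj.
  rewrite -[_ - v]addrC -scaleN1r Ti_lin// scaleN1r -TK ?addNr//.
have T_lin : linear_on (fspan F n) T.
  move=> r x y Dx Dy; rewrite -[RHS]TiK Ti_lin//.
  by rewrite -!TK.
have [a _ Ta] : exists2 a, 0 <= a & op_norm (fspan F n) nrm l2norm T = a%:E.
  apply: (@op_norm_fin _ _ _ _ _ _ _ (n%:R * C)); first by rewrite mulr_ge0.
  move=> x Dx x0; split; first by rewrite normr_gt0; exact/eqP.
  rewrite -mulrA; apply: l2norm_le; first by rewrite mulr_ge0.
  by move=> i; rewrite {2}(TK _ Dx).
have [b _ Tib] : exists2 b, 0 <= b & op_norm setT l2norm nrm Ti = b%:E.
  apply: (@op_norm_fin _ _ _ _ _ _ _ (\sum_(j < n) `|F j|)); first exact: sumr_ge0.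
  move=> v _ v0; split; first exact: l2norm_gt0.
  rewrite mulr_suml (le_trans (ler_norm_sum _ _ _))// ler_sum// => j _.
  by rewrite normrZ mulrC ler_wpM2l// ler_l2norm.
by exists T, Ti, a, b; split=> //; split=> // x Dx; rewrite -TK.
Qed.

End FiniteIso.

(** * Optimising over isomorphisms and coverings *)

Section EntropyFinite.
Context {R : realType} {X : completeNormedModType R}.

Lemma sym_hull_bounded (K : set X) : compact K ->
  exists2 B : R, 0 < B & sym_hull K `<=` ball (0 : X) B.
Proof.
move=> /compact_bounded[B [_ KB]].
pose B1 := Num.max B 0 + 1.
have B1_gt0 : 0 < B1 by rewrite ltr_wpDl// le_max lexx orbT.
have {}KB x : K x -> `|x| <= B1.
  by apply: KB; rewrite /B1 ltr_pwDr// le_max lexx.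
have : sym_hull K `<=` [set x | `|x| <= B1].
  have cl : closed [set x : X | `|x| <= B1].
    apply: (@closed_comp _ _ (fun x : X => `|x|) [set r | r <= B1]).
      by move=> x _; exact: norm_continuous.
    exact: closed_le.
  rewrite [X in _ `<=` X](closure_id _).1//; apply: closureS => _ [m [c [g [c1 Kg ->]]]] /=.
  apply: (le_trans (ler_norm_sum _ _ _)).
  apply: (@le_trans _ _ (\sum_(i < m) `|c i| * B1)).
    by apply: ler_sum => i _; rewrite normrZ ler_wpM2l// KB.
  by rewrite -mulr_suml ler_piMl// ltW.
move=> hullB; exists (B1 + 1); first by rewrite addr_gt0.
by move=> x /hullB /= xB; rewrite -ball_normE/= sub0r normrN; lra.
Qed.

End EntropyFinite.

Section DeltaBound.
Context {R : realType} {X : completeNormedModType R}.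
Local Notation nrm := (fun x : X => `|x|).

Lemma entropy_number_ge0 n (A : set X) : (0 <= entropy_number n A)%E.
Proof. by apply: le_ereal_inf_tmp => _ [e [e0 _] <-]; rewrite lee_fin ltW. Qed.

Lemma delta_ge0 n : (0 <= delta X n)%E.
Proof. by rewrite /delta /sup_ge0 le_max lexx. Qed.

Lemma op_norm_gt0 {U V : lmodType R} (D : set U) (nU : U -> R) (nV : V -> R)
    (A : U -> V) u :
  D u -> u <> 0 -> 0 < nU u -> 0 < nV (A u) -> (0 < op_norm D nU nV A)%E.
Proof.
move=> Du u0 nu0 nAu0.
apply: (@lt_le_trans _ _ (nV (A u) / nU u)%:E); first by rewrite lte_fin divr_gt0.
by rewrite /op_norm /sup_ge0 le_max; apply/orP; right; apply: ereal_sup_ubound; exists u.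
Qed.

Lemma ball_volume_ge0 n : 0 <= @ball_volume R n.
Proof. by apply: le_ball_volume => // u u0; rewrite mul0r measure_ge0. Qed.

Lemma le_dist_l2_delta n (F : nat -> X) (tau : nat -> R) :
  (forall k, (k < n)%N -> 0 < tau k <= dist (F k) (fspan F k)) ->
  (dist_l2 n (fspan F n) <= delta X n)%E.
Proof.
move=> tauF; rewrite /delta /sup_ge0 le_max; apply/orP; right.
apply: ereal_sup_ubound; exists (fspan F n) => //.
exists (fun i : 'I_n => F i); last by rewrite lspan_range.
move=> c c0 i; have [C C0 Cc] := coord_bounded tauF.
pose c' j : R := if insub j is Some i then c i else 0.
have c'E (j : 'I_n) : c' j = c j.
  by rewrite /c' insubT//= => ?; congr c; exact: val_inj.
have := Cc c' i (ltn_ord i); rewrite c'E.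
under eq_bigr => j _ do rewrite c'E.
by rewrite c0 normr0 mulr0 normr_le0 => /eqP.
Qed.

(** The bound of [iso_volume_bound] for all isomorphisms [T] and all radii [e] of
    coverings passes to the infimum in [e], then to the infimum in [T].  These
    are extended reals: the radii have a finite infimum since the hull is
    bounded, and a positive one by [finite_iso_exists]. *)
Lemma prod_dist_le_delta n (K : set X) (F : nat -> X) (tau : nat -> R) :
  compact K -> (0 < n)%N ->
  (forall k, (k < n)%N -> K (F k)) ->
  (forall k, (k < n)%N -> 0 < tau k <= dist (F k) (fspan F k)) ->
  (((\prod_(k < n) tau k) `^ n%:R^-1)%:E <=
   delta X n * ((n`!%:R * ball_volume n) `^ n%:R^-1)%:E *
   entropy_number n (sym_hull K))%E.
Proof.
move=> cK n0 KF tauF.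
set s := _ `^ _; set v := _ `^ _; set E := entropy_number _ _.
have nR0 : n%:R != 0 :> R by rewrite pnatr_eq0 -lt0n.
have s0 : 0 < s.
  by rewrite powR_gt0// prodr_gt0// => k _; have /andP[] := tauF _ (ltn_ord k).
pose covers (e : R) := 0 < e /\
  exists c : 'I_(2 ^ n) -> X, sym_hull K `<=` \bigcup_(i in setT) ball (c i) e.
have bound (T : X -> 'rV[R]_n) Ti (a b e : R) : linear_iso (fspan F n) T Ti ->
    op_norm (fspan F n) nrm l2norm T = a%:E -> op_norm setT l2norm nrm Ti = b%:E ->
    covers e -> s <= v * (a * b * e).
  move=> iso Ta Tib [e0 [c cover]].
  have := iso_volume_bound n0 KF tauF iso Ta Tib e0 cover.
  have abe0 : 0 <= a * b * e.
    have := @op_norm_ge0 _ _ _ (fspan F n) nrm l2norm T; rewrite Ta lee_fin => a0.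
    have := @op_norm_ge0 _ _ _ setT l2norm nrm Ti; rewrite Tib lee_fin => b0.
    by rewrite mulr_ge0 ?mulr_ge0// ltW.
  have nV0 : 0 <= n`!%:R * ball_volume n :> R by rewrite mulr_ge0// ball_volume_ge0.
  move=> /(ge0_ler_powR (_ : 0 <= n%:R^-1)); rewrite !nnegrE invr_ge0 ler0n => le_s.
  apply: (le_trans (le_s isT _ _)).
  - by rewrite prodr_ge0// => k _; have /andP[/ltW] := tauF _ (ltn_ord k).
  - by rewrite mulr_ge0// exprn_ge0.
  rewrite powRM ?exprn_ge0// -/v -powR_mulrn// -powRrM mulfV// powRr1//.
have [B B0 hullB] := sym_hull_bounded cK.
have coversB : covers B.
  split=> //; exists (fun=> 0) => x /hullB xB.
  have p : (0 < 2 ^ n)%N by rewrite expn_gt0.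
  by exists (Ordinal p).
have [T0 [Ti0 [a0 [b0 [iso0 Ta0 Tib0]]]]] := finite_iso_exists tauF.
have ab0 : 0 < v * (a0 * b0).
  have := bound _ _ _ _ _ iso0 Ta0 Tib0 coversB; rewrite mulrA => /(lt_le_trans s0).
  by rewrite pmulr_lgt0.
have v0 : 0 < v.
  rewrite lt_neqAle powR_ge0 andbT; apply/eqP => v0.
  by move: ab0; rewrite -v0 mul0r ltxx.
have E_le : (E <= B%:E)%E by apply: ereal_inf_lbound; exists B.
have E_ge : ((s / (v * (a0 * b0)))%:E <= E)%E.
  apply: le_ereal_inf_tmp => _ [e ce <-].
  by rewrite lee_fin ler_pdivrMr// mulrC -mulrA; exact: (bound _ _ _ _ _ iso0 Ta0 Tib0 ce).
have [e e0 Ee] : exists2 e, 0 < e & E = e%:E.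
  move: E_le E_ge; case: (E) => [r| |]//= _; rewrite lee_fin => se.
  by exists r => //; apply: lt_le_trans se; rewrite divr_gt0.
rewrite Ee -muleA -EFinM.
(* The entropy number is now a positive real [e], so [delta X n] can be isolated. *)
suff : ((s / (v * e))%:E <= delta X n)%E.
  move=> /(lee_wpmul2r (x := (v * e)%:E)).
  rewrite -EFinM divfK ?gt_eqF ?mulr_gt0//; apply.
  by rewrite lee_fin ltW ?mulr_gt0.
apply: le_trans (le_dist_l2_delta tauF).
apply: le_ereal_inf_tmp => _ [T [Ti [iso ->]]].
have D_lin (r : R) x y : fspan F n x -> fspan F n y -> fspan F n (r *: x + y).
  exact: fspanP.
have F0 : fspan F n (F 0%N) by exact: mem_fspan.
have F0_neq0 : F 0%N <> 0.
  move=> F00; have /andP[t0 tF] := tauF _ n0.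
  by apply: (notin_fspan t0 tF); rewrite F00; exact: fspan0.
have TF0 : T (F 0%N) <> 0 by move=> TF; exact/F0_neq0/(linear_iso_eq0 D_lin iso).
have [_ TK _] := iso.
have opT0 : (0 < op_norm (fspan F n) nrm l2norm T)%E.
  apply: (op_norm_gt0 F0) => //; last exact: l2norm_gt0.
  by rewrite normr_gt0; exact/eqP.
have opTi0 : (0 < op_norm setT l2norm nrm Ti)%E.
  apply: (@op_norm_gt0 _ _ _ _ _ _ (T (F 0%N))) => //; first exact: l2norm_gt0.
  by rewrite TK// normr_gt0; exact/eqP.
have := bound T Ti; move: opT0 opTi0.
case: (op_norm (fspan F n) nrm l2norm T) => [a| |]// a_gt0; last first.
  by move=> b_gt0 _; rewrite gt0_mulye// leey.
case: (op_norm setT l2norm nrm Ti) => [b| |]// b_gt0; last first.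
  by move=> _; rewrite gt0_muley// leey.
rewrite !lte_fin in a_gt0 b_gt0.
move=> /(_ a b _ iso erefl erefl) bound_ab.
rewrite -EFinM lee_fin ler_pdivrMr ?mulr_gt0// mulrCA.
rewrite mulrA -ler_pdivrMl ?mulr_gt0// -lee_fin -Ee.
apply: le_ereal_inf_tmp => _ [r cr <-].
by rewrite lee_fin ler_pdivrMl ?mulr_gt0// -mulrA; exact: bound_ab cr.
Qed.

End DeltaBound.

(** * The weak greedy algorithm *)

Section Greedy.
Context {R : realType} {X : completeNormedModType R}.

Lemma dist_fspanS (F : nat -> X) (x : X) k n : (k <= n)%N ->
  dist x (fspan F n) <= dist x (fspan F k).
Proof.
move=> kn; apply: dist_ge; first by exists 0; exact: fspan0.
by move=> y yk; apply: dist_le; exact: fspanS yk.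
Qed.

Lemma sup_ge0_ge0 (A : set \bar R) : (0 <= sup_ge0 A)%E.
Proof. by rewrite /sup_ge0 le_max lexx. Qed.

Lemma sup_distS (K : set X) (F : nat -> X) k n : (k <= n)%N ->
  (sup_dist K (fspan F n) <= sup_dist K (fspan F k))%E.
Proof.
move=> kn; rewrite /sup_dist {1}/sup_ge0 ge_max sup_ge0_ge0/=.
apply: ge_ereal_sup => _ [x Kx <-].
apply: (@le_trans _ _ (dist x (fspan F k))%:E); first by rewrite lee_fin dist_fspanS.
by rewrite /sup_ge0 le_max; apply/orP; right; apply: ereal_sup_ubound; exists x.
Qed.

(** The spaces of the run increase, so the error before step [k <= n] is at least
    the error [s] before step [n], and the element chosen at step [k] is at
    distance at least [alpha k * s] of its predecessors. *)
Lemma weak_greedy_bound (K : set X) (alpha : nat -> R) (f : nat -> X) n :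
  compact K -> (0 < n)%N ->
  (forall k, (1 <= k <= n)%N -> 0 < alpha k) ->
  weak_greedy_run K n alpha f ->
  (sup_dist K (Xspan f n.-1) <=
     ((\prod_(1 <= k < n.+1) alpha k) `^ (- n%:R^-1))%:E
     * delta X n
     * ((n`!%:R * ball_volume n) `^ n%:R^-1)%:E
     * entropy_number n (sym_hull K))%E.
Proof.
move=> cK n0 alpha0 run.
set s := sup_dist _ _; set P := \prod_(_ <= _ < _) _.
have nR0 : n%:R != 0 :> R by rewrite pnatr_eq0 -lt0n.
have : (0 <= s)%E by exact: sup_ge0_ge0.
rewrite le_eqVlt => /predU1P[<-|s0].
  rewrite !mule_ge0 ?lee_fin ?powR_ge0 ?delta_ge0 ?entropy_number_ge0//.
have [r r0 sr] : exists2 r, 0 < r & s = r%:E.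
  have nn : (1 <= n <= n)%N by rewrite n0 leqnn.
  have [_] := run n nn; rewrite -/s; move: s0.
  case: (s) => [r| |]//; first by rewrite lte_fin; exists r.
  by rewrite gt0_muley ?lte_fin ?alpha0// leye_eq.
pose F j := f j.+1.
have KF k : (k < n)%N -> K (F k) by move=> kn; have [] := run k.+1 kn.
have tauF k : (k < n)%N -> 0 < alpha k.+1 * r <= dist (F k) (fspan F k).
  move=> kn; have ak : 0 < alpha k.+1 by exact: alpha0.
  rewrite mulr_gt0//=; have [_] := run k.+1 kn; rewrite /= Xspan_fspan.
  rewrite -lee_fin; apply: le_trans; rewrite EFinM lee_wpmul2l ?lee_fin ?(ltW ak)//.
  by rewrite -sr /s Xspan_fspan; apply: sup_distS; rewrite -ltnS prednK.
have := prod_dist_le_delta cK n0 KF tauF.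
have PE : P = \prod_(k < n) alpha k.+1 by rewrite /P big_add1 big_mkord.
have P0 : 0 < P by rewrite PE prodr_gt0// => k _; apply: alpha0; rewrite ltn_ord.
rewrite big_split/= -PE prodr_const card_ord [(P * _) `^ _]powRM ?exprn_ge0 ?(ltW P0) ?(ltW r0)//.
rewrite -(powR_mulrn _ (ltW r0)) -powRrM mulfV// powRr1 ?(ltW r0)//.
move=> /(lee_wpmul2l (x := (P `^ (- n%:R^-1))%:E)); rewrite lee_fin powR_ge0 => /(_ isT).
rewrite -EFinM mulrA -powRD; last by rewrite (gt_eqF P0) ?implybT.
by rewrite addNr powRr0 mul1r !muleA sr.
Qed.

End Greedy.

(** * Empirical interpolation *)

Section EIM.
Context {R : realType} {X : completeNormedModType R}.
Local Notation nrm := (fun x : X => `|x|).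
Variables (K : set X) (L : set (X -> R^o)) (N : nat).
Variables (f : nat -> X) (l : nat -> X -> R^o) (r g : nat -> X) (Pi : nat -> X -> X).
Hypothesis L_bounded : forall m, L m -> bounded_functional (lspan K) m.
Hypothesis run : eim_run K L N f l r g Pi.
Local Notation S := (lspan K).
Local Notation F := (fun j => f j.+1).
Local Notation G := (fun j => g j.+1).

Lemma Pi_fspan k x : (k <= N)%N -> S x -> fspan G k (Pi k x).
Proof.
case: k => [|k] kN Sx; first by rewrite (eim_Pi0 run)//; exact: fspan0.
by rewrite (eim_Pi run)//; exact: (fspan_ord G).
Qed.

(** [g_(k+1)] and [f_(k+1)] determine each other modulo the image of [Pi_k], which
    is spanned by the earlier functions. *)
Lemma eim_spans k : (k < N)%N ->
  [/\ S (G k), fspan F k.+1 (G k) & fspan G k.+1 (F k)].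
Proof.
elim/ltn_ind: k => k IH kN.
have kb : (1 <= k.+1 <= N)%N by [].
have SF : S (F k) by apply: mem_lspan; exact: (eim_f_in run).
have lt_spans j : (j < k)%N -> [/\ S (G j), fspan F k (G j) & fspan G k (F j)].
  move=> jk; have [SG FG GF] := IH j jk (ltn_trans jk kN).
  by split=> //; [exact: fspanS FG | exact: fspanS GF].
have GP : fspan G k (Pi k (F k)) by apply: Pi_fspan => //; exact: ltnW.
have FP : fspan F k (Pi k (F k)).
  by apply: fspan_trans GP => j jk; have [] := lt_spans j jk.
have SP : S (Pi k (F k)).
  by apply: fspan_lspan GP => j jk; have [] := lt_spans j jk.
have rE : r k.+1 = F k - Pi k (F k) by rewrite (eim_r run).
have gE : G k = (l k.+1 (r k.+1))^-1 *: r k.+1 by rewrite (eim_g run).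
have l0 : l k.+1 (r k.+1) != 0 by exact: (eim_l_neq0 run).
split.
- rewrite gE rE -[_ *: _]addr0; apply: lspan_lin; last exact: lspan0.
  by rewrite addrC -scaleN1r; exact: lspan_lin.
- rewrite gE rE; apply: fspanZ; apply: fspanB; first exact: (mem_fspan F).
  exact: fspanS FP.
- have -> : F k = l k.+1 (r k.+1) *: G k + Pi k (F k).
    by rewrite gE scalerA mulfV// scale1r rE subrK.
  by apply: fspanP; [exact: (mem_fspan G) | exact: fspanS GP].
Qed.

Lemma SG k : (k < N)%N -> S (G k). Proof. by case/eim_spans. Qed.

Lemma l_bounded k : (k < N)%N -> bounded_functional S (l k.+1).
Proof. by move=> kN; apply: L_bounded; exact: (eim_l_in run). Qed.

(** The coefficients of [Pi k x] solve the linear system that expresses the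
    interpolation conditions. *)
Lemma Pi_interp k i x : (i < k)%N -> (k <= N)%N -> eim_matrix l g k \in unitmx ->
  S x -> l i.+1 (Pi k x) = l i.+1 x.
Proof.
move=> ik kN uB Sx; have k0 : (0 < k)%N by exact: leq_ltn_trans ik.
have [l_lin _] := l_bounded (leq_trans ik kN).
rewrite (eim_Pi run) ?k0// (linear_on_sum (A := K) (h := l i.+1)) //; last first.
  by move=> j; apply: SG; exact: leq_trans (ltn_ord j) kN.
have : (eim_matrix l g k *m eim_coef l g k x) (Ordinal ik) 0 = l i.+1 x.
  by rewrite /eim_coef mulmxA mulmxV// mul1mx mxE.
move=> <-; rewrite mxE; apply: eq_bigr => j _.
by rewrite [in RHS]mxE/= mulrC.
Qed.

Lemma eim_matrix_trig k : (k <= N)%N ->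
  (forall i j, (i < j < k)%N -> l i.+1 (G j) = 0) /\
  (forall i, (i < k)%N -> l i.+1 (G i) = 1) ->
  eim_matrix l g k \in unitmx.
Proof.
move=> kN [l0 l1]; rewrite unitmxE det_trig.
  by rewrite big1 ?unitr1// => i _; rewrite mxE l1.
by apply/is_trig_mxP => i j ij; rewrite mxE l0// ij ltn_ord.
Qed.

(** [g_(k+1)] is proportional to [f - Pi_k f], on which the first [k] functionals
    vanish by interpolation; the interpolation property needs the invertibility
    of the matrix of size [k], whence the induction. *)
Lemma l_G k : (k <= N)%N ->
  (forall i j, (i < j < k)%N -> l i.+1 (G j) = 0) /\
  (forall i, (i < k)%N -> l i.+1 (G i) = 1).
Proof.
elim: k => [|k IH] kN; first by split => // i j; rewrite ltn0 andbF.
have IHk := IH (ltnW kN); have [l0 l1] := IHk.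
have uB := eim_matrix_trig (ltnW kN) IHk.
have kb : (1 <= k.+1 <= N)%N by [].
have SF : S (F k) by apply: mem_lspan; exact: (eim_f_in run).
have SP : S (Pi k (F k)).
  by apply: fspan_lspan (Pi_fspan (ltnW kN) SF) => j jk; apply: SG; exact: ltn_trans jk kN.
have rE : r k.+1 = - 1 *: Pi k (F k) + F k by rewrite (eim_r run)// scaleN1r addrC.
have Sr : S (r k.+1) by rewrite rE; exact: lspan_lin.
have lG i : (i < N)%N -> l i.+1 (G k) = (l k.+1 (r k.+1))^-1 * l i.+1 (r k.+1).
  move=> iN; have [l_lin _] := l_bounded iN; rewrite (eim_g run)//.
  have := @linear_on_sum _ _ R^o K (l i.+1) 1 (fun=> (l k.+1 (r k.+1))^-1) (fun=> r k.+1) l_lin.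
  by rewrite !big_ord1; apply.
split=> [i j /andP[ij]|i]; rewrite ltnS leq_eqVlt.
- case/predU1P => [jk|jk]; last by apply: l0; rewrite ij.
  rewrite {}jk in ij *; have iN : (i < N)%N by exact: ltn_trans kN.
  have [l_lin _] := l_bounded iN.
  have li0 : l i.+1 (r k.+1) = 0.
    by rewrite rE (l_lin _ _ _ SP SF) (Pi_interp ij (ltnW kN) uB SF) scaleN1r addNr.
  by rewrite (lG i iN) li0 mulr0.
- case/predU1P => [->|]; last exact: l1.
  by rewrite lG// mulVf//; exact: (eim_l_neq0 run).
Qed.

Lemma eim_unitmx k : (k <= N)%N -> eim_matrix l g k \in unitmx.
Proof. by move=> kN; apply: eim_matrix_trig => //; exact: l_G. Qed.

Lemma Pi_lin k : (k <= N)%N -> linear_on S (Pi k).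
Proof.
move=> kN a x y Sx Sy; have Sxy := lspan_lin a Sx Sy.
case: k kN => [|k] kN; first by rewrite !(eim_Pi0 run)// scaler0 addr0.
rewrite !(eim_Pi run)// scaler_sumr -big_split/=; apply: eq_bigr => j _.
rewrite scalerA -scalerDl; congr (_ *: _).
have -> : eim_coef l g k.+1 (a *: x + y) = a *: eim_coef l g k.+1 x + eim_coef l g k.+1 y.
  rewrite /eim_coef scalemxAr -mulmxDr; congr (_ *m _).
  apply/colP => i; rewrite !mxE.
  by have [-> //] := l_bounded (leq_trans (ltn_ord i) kN).
by rewrite !mxE.
Qed.

Lemma Pi_G k j : (j < k)%N -> (k <= N)%N -> Pi k (G j) = G j.
Proof.
move=> jk kN; have k0 : (0 < k)%N by exact: leq_ltn_trans jk.
rewrite (eim_Pi run) ?k0//; last by apply: SG; exact: leq_trans jk kN.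
have -> : eim_coef l g k (G j) = delta_mx (Ordinal jk) 0.
  rewrite /eim_coef (_ : \col_i _ = eim_matrix l g k *m delta_mx (Ordinal jk) 0).
    by rewrite mulKmx// eim_unitmx.
  by rewrite -colE; apply/colP => i; rewrite !mxE.
rewrite (bigD1 (Ordinal jk))//= !mxE !eqxx scale1r big1 ?addr0// => i /negbTE ij.
by rewrite mxE ij scale0r.
Qed.

Lemma Pi_id k y : (k <= N)%N -> fspan F k y -> S y /\ Pi k y = y.
Proof.
move=> kN Fy.
have [c yE] : fspan G k y.
  apply: fspan_trans Fy => j jk.
  by have [_ _ +] := eim_spans (leq_trans jk kN); exact: fspanS.
have SGj (j : 'I_k) : S (G j) by apply: SG; exact: leq_trans (ltn_ord j) kN.
split; first by rewrite yE; exact: lspan_sum.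
rewrite {1}yE (linear_on_sum _ (Pi_lin kN))// yE.
by apply: eq_bigr => j _; rewrite Pi_G.
Qed.

(** This is where the boundedness of the functionals enters. *)
Lemma Pi_bounded k : (k <= N)%N ->
  exists2 C, 0 <= C & forall x, S x -> `|Pi k x| <= C * `|x|.
Proof.
case: k => [|k] kN.
  by exists 0 => // x Sx; rewrite (eim_Pi0 run)// normr0 mul0r.
have lC (i : 'I_k.+1) : exists C, forall x, S x -> `|l i.+1 x| <= C * `|x|.
  by have [_ [C]] := l_bounded (leq_trans (ltn_ord i) kN); exists C.
have [C lCx] := choice lC.
pose A := invmx (eim_matrix l g k.+1).
pose B := \sum_(j < k.+1) (\sum_(i < k.+1) `|A j i| * `|C i|) * `|G j|.
exists B => [|x Sx].
  by apply: sumr_ge0 => j _; rewrite mulr_ge0// sumr_ge0// => i _; rewrite mulr_ge0.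
rewrite (eim_Pi run)// mulr_suml (le_trans (ler_norm_sum _ _ _))// ler_sum// => j _.
rewrite normrZ mulrAC ler_wpM2r// mxE mulr_suml.
rewrite (le_trans (ler_norm_sum _ _ _))// ler_sum// => i _.
rewrite normrM -mulrA ler_wpM2l// mxE (le_trans (lCx i x Sx))//.
by rewrite ler_wpM2r// ler_norm.
Qed.

Lemma residual_in_lspan k : (k < N)%N -> S (r k.+1).
Proof.
move=> kN; have SF : S (F k) by apply: mem_lspan; exact: (eim_f_in run).
have SP : S (Pi k (F k)).
  by apply: fspan_lspan (Pi_fspan (ltnW kN) SF) => j jk; apply: SG; exact: ltn_trans kN.
by rewrite (eim_r run)// addrC -scaleN1r; exact: lspan_lin.
Qed.

Lemma residual_neq0 k : (k < N)%N -> r k.+1 <> 0.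
Proof.
move=> kN r0; have := eim_l_neq0 run (n := k.+1) kN; rewrite r0.
have [l_lin _] := l_bounded kN.
have := @linear_on_sum _ _ R^o K (l k.+1) 0 (fun=> 0) (fun=> 0) l_lin.
by rewrite !big_ord0 => ->; [rewrite eqxx | case].
Qed.

Lemma residual_fixed k : (k < N)%N -> r k.+1 - Pi k (r k.+1) = r k.+1.
Proof.
move=> kN; have kN' := ltnW kN.
have SF : S (F k) by apply: mem_lspan; exact: (eim_f_in run).
have FP : fspan F k (Pi k (F k)).
  apply: fspan_trans (Pi_fspan kN' SF) => j jk.
  by have [_ + _] := eim_spans (ltn_trans jk kN); exact: fspanS.
have [SP PP] := Pi_id kN' FP.
have rE : r k.+1 = - 1 *: Pi k (F k) + F k by rewrite (eim_r run)// scaleN1r addrC.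
by rewrite {2}rE Pi_lin// PP scaleN1r addNr subr0.
Qed.

(** [I - Pi k] is bounded, and its norm is at least [1] because it fixes the
    nonzero residual of the next step. *)
Lemma gamma_fin k : (k < N)%N ->
  exists2 c : R, 1 <= c & eim_gamma K Pi k = c%:E /\
    forall x, S x -> `|x - Pi k x| <= c * `|x|.
Proof.
move=> kN; have kN' := ltnW kN.
have [k0|k_gt0] := posnP k.
  subst k; exists 1 => //; split=> // x Sx.
  by rewrite (eim_Pi0 run)// subr0 mul1r.
have -> : eim_gamma K Pi k = op_norm S nrm nrm (fun x => x - Pi k x) by case: (k) k_gt0.
have [C C0 PC] := Pi_bounded kN'.
have [c c0 cE] : exists2 c, 0 <= c & op_norm S nrm nrm (fun x => x - Pi k x) = c%:E.
  apply: (@op_norm_fin _ _ _ _ _ _ _ (1 + C)); first by rewrite addr_ge0.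
  move=> x Sx x0; split; first by rewrite normr_gt0; exact/eqP.
  by rewrite (le_trans (ler_normB _ _))// mulrDl mul1r lerD2l PC.
have cx x : S x -> `|x - Pi k x| <= c * `|x|.
  move=> Sx; have [->|/eqP x0] := eqVneq x 0.
    have [_ ->] := Pi_id kN' (fspan0 F k).
    by rewrite subrr normr0 mulr0.
  by apply: (le_op_norm cE) => //; rewrite normr_gt0; exact/eqP.
exists c; last by [].
have := cx _ (residual_in_lspan kN); rewrite residual_fixed//.
rewrite -[X in X <= _]mul1r ler_pM2r// normr_gt0.
exact/eqP/residual_neq0.
Qed.

(** [Pi k] is the identity on the span, so [h - Pi k h] does not change when an
    element of the span is subtracted from [h]. *)
Lemma error_le_dist k c h : (k < N)%N -> 0 < c ->
  (forall x, S x -> `|x - Pi k x| <= c * `|x|) -> K h ->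
  `|h - Pi k h| <= c * dist h (fspan F k).
Proof.
move=> kN c0 cx Kh; have kN' := ltnW kN.
have Sh : S h by exact: mem_lspan.
rewrite -ler_pdivrMl//; apply: dist_ge; first by exists 0; exact: fspan0.
move=> y Fy; rewrite ler_pdivrMl//; have [Sy Py] := Pi_id kN' Fy.
have E : h - y = -1 *: y + h by rewrite scaleN1r addrC.
have Shy : S (h - y) by rewrite E; exact: lspan_lin.
have := cx _ Shy; rewrite [Pi k _](_ : _ = Pi k h - y).
  by rewrite opprB addrA subrK.
by rewrite E Pi_lin// Py scaleN1r addrC.
Qed.

Lemma dist_le_error k h : (k < N)%N -> K h ->
  dist h (fspan F k) <= `|h - Pi k h|.
Proof.
move=> kN Kh; apply: dist_le.
apply: fspan_trans (Pi_fspan (ltnW kN) (mem_lspan Kh)) => j jk.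
by have [_ + _] := eim_spans (ltn_trans jk kN); exact: fspanS.
Qed.

Lemma eim_bound n : compact K -> (1 <= n <= N)%N ->
  (sup_ge0 [set `|h - Pi n.-1 h|%:E | h in K] <=
     eim_gamma K Pi n.-1
     * (\prod_(1 <= k < n) eim_gamma K Pi k) `^ n%:R^-1
     * delta X n
     * ((n`!%:R * ball_volume n) `^ n%:R^-1)%:E
     * entropy_number n (sym_hull K))%E.
Proof.
move=> cK /andP[n0 nN].
pose c k := fine (eim_gamma K Pi k).
have cP k : (k < N)%N -> [/\ 1 <= c k, eim_gamma K Pi k = (c k)%:E &
    forall x, S x -> `|x - Pi k x| <= c k * `|x|].
  by move=> kN; have [d d1 [dE dx]] := gamma_fin kN; rewrite /c dE.
have c_gt0 k : (k < N)%N -> 0 < c k by move=> /cP[c1 _ _]; exact: lt_le_trans c1.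
have pN : (n.-1 < N)%N by rewrite prednK.
(* [c k] is the real number [gamma_k]; step [k + 1] compares with [Pi k]. *)
have greedy : weak_greedy_run K n (fun k => (c k.-1)^-1) f.
  move=> [|k] // /andP[_ kn]; have kN : (k < N)%N by exact: leq_trans nN.
  have kb : (1 <= k.+1 <= N)%N by [].
  split; first exact: (eim_f_in run).
  rewrite /= Xspan_fspan; have [c1 _ cx] := cP k kN.
  have fd := error_le_dist kN (c_gt0 k kN) cx (eim_f_in run kb).
  rewrite muleC lee_pdivrMr ?c_gt0// -EFinM mulrC.
  apply: (@le_trans _ _ `|r k.+1|%:E); last by rewrite lee_fin (eim_r run).
  rewrite /sup_dist {1}/sup_ge0 ge_max lee_fin normr_ge0/=.
  apply: ge_ereal_sup => _ [h Kh <-]; rewrite lee_fin.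
  exact: le_trans (dist_le_error kN Kh) (eim_f_max run kb Kh).
have alpha0 k : (1 <= k <= n)%N -> 0 < (c k.-1)^-1.
  case: k => // k /andP[_ kn]; rewrite invr_gt0 c_gt0//.
  exact: leq_trans nN.
have := weak_greedy_bound cK n0 alpha0 greedy.
have -> : (\prod_(1 <= k < n.+1) (c k.-1)^-1) `^ (- n%:R^-1) =
    (\prod_(1 <= k < n) c k) `^ n%:R^-1.
  have P0 : 0 < \prod_(0 <= k < n) c k.
    by rewrite big_mkord prodr_gt0// => k _; apply: c_gt0; exact: leq_trans (ltn_ord k) nN.
  rewrite big_add1/= prodfV -[(\prod_(_ <= _ < _) _)^-1]powR_inv1 ?(ltW P0)//.
  rewrite -powRrM mulrN mulN1r opprK.
  by rewrite big_ltn// {1}/c/= mul1r.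
move=> bound.
have [c1 -> cx] := cP _ pN.
have -> : (\prod_(1 <= k < n) eim_gamma K Pi k)%E = (\prod_(1 <= k < n) c k)%:E.
  rewrite -prodEFin; apply: eq_big_nat => k /andP[_ kn].
  by have [_ ->] := cP k (leq_trans kn nN).
rewrite poweR_EFin -!muleA; rewrite -!muleA in bound.
apply: (@le_trans _ _ ((c n.-1)%:E * sup_dist K (Xspan f n.-1))%E); last first.
  by apply: lee_wpmul2l => //; rewrite lee_fin ltW// c_gt0.
rewrite {1}/sup_ge0 ge_max mule_ge0 ?sup_ge0_ge0 ?lee_fin ?(ltW (c_gt0 _ pN))//=.
apply: ge_ereal_sup => _ [h Kh <-].
apply: (@le_trans _ _ ((c n.-1)%:E * (dist h (Xspan f n.-1))%:E)%E).
  by rewrite -EFinM lee_fin Xspan_fspan error_le_dist ?c_gt0.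
apply: lee_wpmul2l; first by rewrite lee_fin ltW// c_gt0.
by rewrite /sup_dist /sup_ge0 le_max; apply/orP; right; apply: ereal_sup_ubound; exists h.
Qed.

End EIM.

Unset Implicit Arguments.

Theorem theorem3p2 (R : realType) (X : completeNormedModType R) (K : set X)
    (K_neq0 : K !=set0) (K_compact : compact K) :
  (forall (alpha : nat -> R) (N : nat) (f : nat -> X),
     (forall n, (1 <= n)%N -> 0 < alpha n <= 1) ->
     (1 <= N)%N ->
     weak_greedy_run K N alpha f ->
     forall n, (1 <= n <= N)%N ->
     (sup_dist K (Xspan f n.-1) <=
        ((\prod_(1 <= k < n.+1) alpha k) `^ (- n%:R^-1))%:E
        * delta X n
        * ((n`!%:R * ball_volume n) `^ n%:R^-1)%:E
        * entropy_number n (sym_hull K))%E)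
  /\
  (forall (L : set (X -> R^o)) (N : nat) (f : nat -> X) (l : nat -> X -> R^o)
          (r g : nat -> X) (Pi : nat -> X -> X),
     (forall m, L m -> bounded_functional (lspan K) m) ->
     (1 <= N)%N ->
     eim_run K L N f l r g Pi ->
     forall n, (1 <= n <= N)%N ->
     (sup_ge0 [set `|h - Pi n.-1 h|%:E | h in K] <=
        eim_gamma K Pi n.-1
        * (\prod_(1 <= k < n) eim_gamma K Pi k) `^ n%:R^-1
        * delta X n
        * ((n`!%:R * ball_volume n) `^ n%:R^-1)%:E
        * entropy_number n (sym_hull K))%E).
Proof.
split.
  move=> alpha N f alpha01 _ run n /andP[n0 nN].
  apply: weak_greedy_bound => //.
    by move=> k /andP[k0 _]; have /andP[] := alpha01 k k0.
  move=> k /andP[k0 kn]; apply: run.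
  by rewrite k0 (leq_trans kn).
move=> L N f l r g Pi L_bounded _ run n nN.
exact: (eim_bound L_bounded run K_compact nN).
Qed.
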